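(* Let $\mu,\lambda\in\mathbb R$ with $\mu>0$ and $\mu+\lambda>0$. Then there exist a disk $B\subset\mathbb R^2$, a bounded convex domain $D\subset\mathbb R^2$ and a smooth diffeomorphism $\Phi:\partial B\to\partial D$ such that the unique solution $u\in W^{1,2}(B,\mathbb R^2)$ to $$ \left\{ \begin{array}{ll} \mu\,\mathrm{div}\big((\nabla u)^T+\nabla u\big)+\lambda\,\nabla(\mathrm{div}\,u)=0 & \text{in } B,\\ u=\Phi & \text{on } \partial B, \end{array} \right. $$ is not a homeomorphism of $B$ onto $D$.
   Context: The disk $B$ is open. The system is the planar Lamé system of isotropic linearized elasticity with constant Lamé coefficients $\mu,\lambda$. Here $u=(u^1,u^2)$, $\nabla u$ is the $2\times 2$ Jacobian matrix of $u$, $(\nabla u)^T$ its transpose, and the divergence of a matrix field is taken row by row; thus the system reads, for $i=1,2$, $\mu\sum_{j=1}^2\partial_j(\partial_j u^i+\partial_i u^j)+\lambda\,\partial_i(\partial_1u^1+\partial_2u^2)=0$. *)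

(* Defs.v *)
From HB Require Import structures.
From mathcomp Require Import all_boot all_order all_algebra.
From mathcomp Require Import all_classical all_reals all_analysis.

Set Implicit Arguments.
Unset Strict Implicit.
Unset Printing Implicit Defensive.

Import Order.TTheory GRing.Theory Num.Theory.
Import numFieldNormedType.Exports.

Local Open Scope classical_set_scope.
Local Open Scope ring_scope.

Section Plane.
Variable R : realType.

Implicit Types (A B C : set (R * R)) (i j : 'I_2).
Implicit Types (f : R * R -> R) (u : R * R -> R * R).

Definition leb2 := (@lebesgue_measure R \x @lebesgue_measure R)%E.

(* The norm that the library puts on [R * R] is the maximum norm, whose balls
   are squares, so the Euclidean disk is spelled out. *)
Definition disk (c : R * R) (r : R) : set (R * R) :=
  [set p | (p.1 - c.1) ^+ 2 + (p.2 - c.2) ^+ 2 < r ^+ 2].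

Definition boundary A : set (R * R) := closure A `\` interior A.

Definition cpt u i (p : R * R) : R := if i == 0 then (u p).1 else (u p).2.

Definition basis2 i : R * R := if i == 0 then (1, 0) else (0, 1).

Definition pd i f (p : R * R) : R := 'D_(basis2 i) f p.

(* Meaningful for [A] open: every iterated partial derivative exists and is
   continuous at each point of [A]. *)
Definition smooth_on A f :=
  forall (s : seq 'I_2) p, A p ->
    {for p, continuous (foldr pd f s)} /\
    (forall i, derivable (foldr pd f s) p (basis2 i)).

(* Smooth maps and diffeomorphisms between arbitrary subsets of the plane: near
   each point of [A], [u] is the restriction to [A] of a smooth map defined on
   an open set. *)
Definition smooth_map A u :=
  forall p, A p -> exists (U : set (R * R)) (F : R * R -> R * R),
    [/\ open U, U p, forall i, smooth_on U (cpt F i) &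
        forall q, A q -> U q -> u q = F q].

Definition smooth_diffeo A C u :=
  [/\ set_bij A C u, smooth_map A u &
      exists v, smooth_map C v /\ {in A, cancel u v}].

Definition homeo A C u :=
  [/\ set_bij A C u, {within A, continuous u} &
      exists v, {within C, continuous v} /\ {in A, cancel u v}].

Definition test_fun B f :=
  [/\ smooth_on setT f, compact (closure [set p | f p != 0]) &
      closure [set p | f p != 0] `<=` B].

Definition L2 B f :=
  measurable_fun B f /\ (\int[leb2]_(p in B) ((f p) ^+ 2)%:E < +oo)%E.

Definition weak_pd B i f (g : R * R -> R) :=
  forall phi, test_fun B phi ->
    \int[leb2]_(p in B) (f p * pd i phi p) =
    - \int[leb2]_(p in B) (g p * phi p).

Definition W12_grad B f (g : 'I_2 -> R * R -> R) :=
  L2 B f /\ forall i, L2 B (g i) /\ weak_pd B i f (g i).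

(* The closure of the test functions in the norm of W^{1,2}(B). *)
Definition W12_0 B f :=
  exists2 g, W12_grad B f g &
    forall e : R, 0 < e -> exists2 phi, test_fun B phi &
      (\int[leb2]_(p in B)
         ((f p - phi p) ^+ 2 + \sum_(i < 2) (g i p - pd i phi p) ^+ 2)%:E
       < e%:E)%E.

(* [u = Phi] on the boundary in the sense of W^{1,2}(B) when [Phi] is smooth on
   it: [u] differs by an element of W^{1,2}_0(B) from a smooth extension of
   [Phi] to the plane. *)
Definition has_trace B u (Phi : R * R -> R * R) :=
  exists Psi : R * R -> R * R,
    [/\ forall i, smooth_on setT (cpt Psi i),
        forall p, boundary B p -> Psi p = Phi p &
        forall i, W12_0 B (fun p => cpt u i p - cpt Psi i p)].

(* [Du i j] is the weak derivative of the [i]-th component of [u] in the [j]-th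
   direction, and the Lame system is read in the sense of distributions. *)
Definition lame_solution (mu lambda : R) B (Phi u : R * R -> R * R) :=
  has_trace B u Phi /\
  exists Du : 'I_2 -> 'I_2 -> R * R -> R,
    (forall i, W12_grad B (cpt u i) (Du i)) /\
    forall i phi, test_fun B phi ->
      \int[leb2]_(p in B)
        (mu * (\sum_(j < 2) (Du i j p + Du j i p) * pd j phi p)
         + lambda * (\sum_(j < 2) Du j j p) * pd i phi p) = 0.

End Plane.

(* Main.v *)
Require Import Defs.
From HB Require Import structures.
From mathcomp Require Import all_boot all_order all_algebra.
From mathcomp Require Import all_classical all_reals all_analysis.
From mathcomp Require Import ring lra.

Set Implicit Arguments.
Unset Strict Implicit.
Unset Printing Implicit Defensive.

Import Order.TTheory GRing.Theory Num.Theory.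
Import numFieldNormedType.Exports.

Local Open Scope classical_set_scope.
Local Open Scope ring_scope.

(** The displacement exploits the coupling of the two components in the Lame
    system.  A quadratic boundary value in the first component alone forces a
    nonzero second component inside the disk: for [(x + y) ^+ 2 / 4] on the unit
    circle the first component of the solution is [(1 + 2 * x * y) / 4] and the
    second one is the bump [c * (1 - x ^+ 2 - y ^+ 2)] with
    [c = (m + l) / (4 * (3 * m + l)) > 0], where [m] and [l] are the Lame
    coefficients.  Linear maps solve the system as well, so the boundary map
    [Phi (x, y) = (x - y + (x + y) ^+ 2 / 4, d * (x + y))] is on the circle the
    value of the solution [u] whose first component is
    [x - y + (1 + 2 * x * y) / 4] and whose second component is
    [d * (x + y) + c * (1 - x ^+ 2 - y ^+ 2)].  As [d] gets small the image of the
    circle gets flat while the bump keeps its height: with [d = c / 2] the centre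
    of the disk is sent to height [c = 2 * d], whereas every point of the target
    domain has height below [sqrt 2 * d].  Hence no continuous representative of
    the solution maps the disk into the domain ([sol_not_homeo]).

    The formula of [Phi] is a linear map followed by a shear, so it is a
    polynomial automorphism of the plane with a polynomial inverse.  This makes
    [Phi] a smooth diffeomorphism between the boundaries of the disk and of its
    image ([shear_diffeo]), and the image is convex because the factor [1 / 4] is
    small compared with the uniform convexity of the disk ([sheared_convex]).

    That the solution is unique, for data attained in the sense of [W^{1,2}_0],
    is an energy argument ([lame_unique]).  Let [w] be the difference of two
    solutions.  It is a sum of elements of [W^{1,2}_0] and of a function that is
    smooth on the plane and vanishes on the circle; the latter is also a limit of
    test functions ([smooth_W12_closure]), by means of cutoffs
    built from [exp (- 1 / t)].  Testing the system with functions [psi] close to [w]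
    bounds the diagonal derivatives [d_i psi_i] by the distance from [psi] to [w]
    ([Int_energy]), and the Poincare inequality in the direction [i] for the
    component [i] ([Poincare_test]) bounds [psi_i] by [d_i psi_i].  Letting [psi]
    tend to [w] gives [w = 0]. *)

(** * Smooth functions of two variables *)

Section Smooth.
Variable R : realType.
Implicit Types (f g : R * R -> R) (p v : R * R) (i j : 'I_2).

(** A directional derivative is the derivative along a line, with literally the
    same difference quotients; this transfers the one-variable calculus. *)
Lemma line_quotient f p v (t : R) :
  (fun h : R => h^-1 *: (((fun s : R => f (p + s *: v)) \o shift t) (h *: 1) - f (p + t *: v)))
  = (fun h : R => h^-1 *: ((f \o shift (p + t *: v)) (h *: v) - f (p + t *: v))).
Proof.
apply/funext => h /=; congr (_ *: (f _ - _)).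
have -> : h *: (1 : R) = h by exact: mulr1.
by rewrite scalerDl addrCA.
Qed.

Lemma derivable_line f p v t :
  derivable (fun s : R => f (p + s *: v)) t 1 = derivable f (p + t *: v) v.
Proof. by rewrite /derivable line_quotient. Qed.

Lemma derive_line f p v t :
  'D_1 (fun s : R => f (p + s *: v)) t = 'D_v f (p + t *: v).
Proof. by rewrite /derive line_quotient. Qed.

Lemma is_derive_line f p v df :
  is_derive (0 : R) (1 : R) (fun s : R => f (p + s *: v)) df -> is_derive p v f df.
Proof.
move=> [h1 h2]; split.
  by move: h1; rewrite derivable_line scale0r addr0.
by move: h2; rewrite derive_line scale0r addr0.
Qed.

Lemma is_derive_comp (h : R -> R) f p v dh df :
  is_derive p v f df -> is_derive (f p) (1:R) h dh ->
  is_derive p v (h \o f) (dh * df).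
Proof.
move=> [f1 f2] hh; apply: is_derive_line.
have E : is_derive (0:R) (1:R) (fun s : R => f (p + s *: v)) df.
  split; first by rewrite derivable_line scale0r addr0.
  by rewrite derive_line scale0r addr0.
have hh' : is_derive (f (p + 0 *: v)) (1:R) h dh by rewrite scale0r addr0.
have := @is_derive1_comp R h (fun s : R => f (p + s *: v)) 0 dh df hh' E.
by [].
Qed.

Lemma is_derive_fst p v : is_derive p v (fun q : R * R => q.1) v.1.
Proof.
apply: is_derive_line => /=.
have -> : (fun s : R => p.1 + s *: v.1) = (fun s : R => p.1 + s * v.1) by [].
by apply: is_derive_eq; rewrite /GRing.scale /=; ring.
Qed.

Lemma is_derive_snd p v : is_derive p v (fun q : R * R => q.2) v.2.
Proof.
apply: is_derive_line => /=.
have -> : (fun s : R => p.2 + s *: v.2) = (fun s : R => p.2 + s * v.2) by [].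
by apply: is_derive_eq; rewrite /GRing.scale /=; ring.
Qed.

(** A type of its own rather than a conjunction, so that automation does not
    unfold it down to filters of difference quotients. *)
Variant pderivable f : Prop :=
  Pderivable of continuous f & (forall p i, derivable f p (basis2 R i)).

(** The derivatives are peeled from the inside, [smooth_upto n.+1 f] being a
    statement about [pd i f]: the Leibniz rule then goes through by induction on [n]. *)
Fixpoint smooth_upto n f :=
  pderivable f /\ if n is n'.+1 then forall i, smooth_upto n' (pd i f) else True.

(** Peeling the innermost derivative removes the last element of the list of
    directions, not the first. *)
Lemma smooth_uptoP f : (forall n, smooth_upto n f) <-> smooth_on setT f.
Proof.
have H n : forall f, smooth_upto n f <->
    forall s : seq 'I_2, (size s <= n)%N -> pderivable (foldr (@pd R) f s).
  elim: n => [|n IH] {}f /=.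
    split=> [[h _] [|]//|h].
    by split; [exact: (h [::])|].
  split=> [[h1 h2] s|h].
    case/lastP: s => [//|s i]; rewrite size_rcons => hs.
    by rewrite foldr_rcons; apply: (IH _).1 (h2 i) _ hs.
  split; first exact: (h [::]).
  move=> i; apply/IH => s hs.
  by rewrite -(foldr_rcons (@pd R)); apply: h; rewrite size_rcons.
split=> [h s p _|h n].
  have [h1 h2] := (H (size s) f).1 (h _) s (leqnn _).
  by split; [exact: h1|exact: h2].
apply/H => s _; split; first by move=> p; apply: (h s p _).1.
by move=> p i; apply: (h s p _).2.
Qed.

Lemma smooth_pd i f : smooth_on setT f -> smooth_on setT (pd i f).
Proof. by move=> /smooth_uptoP h; apply/smooth_uptoP => n; apply: (h n.+1).2. Qed.

Lemma smooth_cont f : smooth_on setT f -> continuous f.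
Proof. by move=> /smooth_uptoP/(_ 0%N)[[]]. Qed.

Lemma smooth_deriv f : smooth_on setT f -> forall p i, derivable f p (basis2 R i).
Proof. by move=> /smooth_uptoP/(_ 0%N)[[]]. Qed.

Lemma is_derive_pd f p i : smooth_on setT f -> is_derive p (basis2 R i) f (pd i f p).
Proof. by move=> sf; split => //; apply: smooth_deriv. Qed.

Lemma pdE f i df : (forall p, is_derive p (basis2 R i) f (df p)) -> pd i f = df.
Proof. by move=> h; apply/funext => p; rewrite /pd; apply: derive_val. Qed.

Lemma pd_cst i (a : R) : pd i (fun=> a) = (fun=> 0).
Proof. by apply: pdE => p; apply: is_derive_cst. Qed.

Lemma pd_fst i : pd i (fun p : R * R => p.1) = (fun=> (basis2 R i).1).
Proof. by apply: pdE => p; apply: is_derive_fst. Qed.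

Lemma pd_snd i : pd i (fun p : R * R => p.2) = (fun=> (basis2 R i).2).
Proof. by apply: pdE => p; apply: is_derive_snd. Qed.

Lemma is_derive_mul f g p v df dg : is_derive p v f df -> is_derive p v g dg ->
  is_derive p v (fun q => f q * g q) (df * g p + f p * dg).
Proof.
move=> h1 h2; have := is_deriveM h1 h2.
by move=> /is_derive_eq; apply; rewrite /GRing.scale /=; ring.
Qed.

Lemma is_derive_add f g p v df dg : is_derive p v f df -> is_derive p v g dg ->
  is_derive p v (fun q => f q + g q) (df + dg).
Proof. by move=> h1 h2; exact: is_deriveD. Qed.

Lemma pderivableM f g : pderivable f -> pderivable g -> pderivable (fun p => f p * g p).
Proof.
move=> [f1 f2] [g1 g2]; split; first by move=> p; apply: cvgM; [exact: f1|exact: g1].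
by move=> p i; apply: derivableM.
Qed.

Lemma pderivableD f g : pderivable f -> pderivable g -> pderivable (fun p => f p + g p).
Proof.
move=> [f1 f2] [g1 g2]; split; first by move=> p; apply: cvgD; [exact: f1|exact: g1].
by move=> p i; apply: derivableD.
Qed.

Lemma pderivable_is_derive f : pderivable f -> forall p i, is_derive p (basis2 R i) f (pd i f p).
Proof. by move=> [_ h] p i; split; [exact: h|]. Qed.

Lemma pderivable_pdM f g i : pderivable f -> pderivable g ->
  pd i (fun p => f p * g p) = (fun p => pd i f p * g p + f p * pd i g p).
Proof. by move=> hf hg; apply: pdE => p; apply: is_derive_mul; apply: pderivable_is_derive. Qed.

Lemma pderivable_pdD f g i : pderivable f -> pderivable g ->
  pd i (fun p => f p + g p) = (fun p => pd i f p + pd i g p).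
Proof. by move=> hf hg; apply: pdE => p; apply: is_derive_add; apply: pderivable_is_derive. Qed.

Lemma smooth_uptoD n f g : smooth_upto n f -> smooth_upto n g -> smooth_upto n (fun p => f p + g p).
Proof.
elim: n f g => [|n IH] f g [f1 f2] [g1 g2]; split; try exact: pderivableD; try exact: Logic.I.
by move=> i; rewrite (pderivable_pdD i f1 g1); apply: IH; [exact: f2|exact: g2].
Qed.

Lemma smooth_uptoS n f : smooth_upto n.+1 f -> smooth_upto n f.
Proof.
elim: n f => [|n IH] f [f1 f2]; split; [exact: f1|exact: Logic.I|exact: f1|].
by move=> i; apply: IH; exact: f2.
Qed.

(** The Leibniz rule leaves products with one factor differentiated, and the
    other factor has one order of smoothness to spare. *)
Lemma smooth_uptoM n f g : smooth_upto n f -> smooth_upto n g -> smooth_upto n (fun p => f p * g p).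
Proof.
elim: n f g => [|n IH] f g.
  by move=> [f1 f2] [g1 g2]; split; [exact: pderivableM|exact: Logic.I].
move=> hf hg; have [f1 f2] := hf; have [g1 g2] := hg; split; first exact: pderivableM.
move=> i; rewrite (pderivable_pdM i f1 g1); apply: smooth_uptoD; apply: IH.
- exact: f2.
- exact: smooth_uptoS.
- exact: smooth_uptoS.
- exact: g2.
Qed.

Lemma smooth_mul f g : smooth_on setT f -> smooth_on setT g ->
  smooth_on setT (fun p => f p * g p).
Proof. by move=> /smooth_uptoP hf /smooth_uptoP hg; apply/smooth_uptoP => n; apply: smooth_uptoM. Qed.

Lemma smooth_add f g : smooth_on setT f -> smooth_on setT g ->
  smooth_on setT (fun p => f p + g p).
Proof. by move=> /smooth_uptoP hf /smooth_uptoP hg; apply/smooth_uptoP => n; apply: smooth_uptoD. Qed.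

Lemma smooth_cst (a : R) : smooth_on setT (fun _ : R * R => a).
Proof.
have h b : pderivable (fun _ : R * R => b).
  by split; [move=> p; exact: cvg_cst|move=> p i; apply: derivable_cst].
apply/smooth_uptoP => n; elim: n a => [|n IH] a; split; try exact: h; first exact: Logic.I.
by move=> i; rewrite pd_cst; exact: IH.
Qed.

Lemma smooth_fst : smooth_on setT (fun p : R * R => p.1).
Proof.
have h : pderivable (fun p : R * R => p.1).
  split; first by move=> p; exact: cvg_fst.
  by move=> p i; have [] := is_derive_fst p (basis2 R i).
apply/smooth_uptoP => -[|n]; split; try exact: h; first exact: Logic.I.
move=> i; rewrite pd_fst.
by move/smooth_uptoP: (smooth_cst (basis2 R i).1); apply.
Qed.

Lemma smooth_snd : smooth_on setT (fun p : R * R => p.2).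
Proof.
have h : pderivable (fun p : R * R => p.2).
  split; first by move=> p; exact: cvg_snd.
  by move=> p i; have [] := is_derive_snd p (basis2 R i).
apply/smooth_uptoP => -[|n]; split; try exact: h; first exact: Logic.I.
move=> i; rewrite pd_snd.
by move/smooth_uptoP: (smooth_cst (basis2 R i).2); apply.
Qed.

Lemma smooth_scale (a : R) f : smooth_on setT f -> smooth_on setT (fun p => a * f p).
Proof. by move=> hf; apply: smooth_mul; [exact: smooth_cst|exact: hf]. Qed.

Lemma smooth_opp f : smooth_on setT f -> smooth_on setT (fun p => - f p).
Proof.
move=> hf; have -> : (fun p => - f p) = (fun p => (-1) * f p).
  by apply/funext => p; rewrite mulN1r.
exact: smooth_scale.
Qed.

Lemma smooth_sub f g : smooth_on setT f -> smooth_on setT g ->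
  smooth_on setT (fun p => f p - g p).
Proof. by move=> hf hg; apply: smooth_add; [exact: hf|exact: smooth_opp]. Qed.

Lemma smooth_sqr f : smooth_on setT f -> smooth_on setT (fun p => f p ^+ 2).
Proof. by move=> hf; exact: smooth_mul. Qed.

Lemma pdM f g i : smooth_on setT f -> smooth_on setT g ->
  pd i (fun p => f p * g p) = (fun p => pd i f p * g p + f p * pd i g p).
Proof. by move=> hf hg; apply: pdE => p; apply: is_derive_mul; apply: is_derive_pd. Qed.

Lemma pdD f g i : smooth_on setT f -> smooth_on setT g ->
  pd i (fun p => f p + g p) = (fun p => pd i f p + pd i g p).
Proof. by move=> hf hg; apply: pdE => p; apply: is_derive_add; apply: is_derive_pd. Qed.

Lemma pdZ (a : R) f i : smooth_on setT f ->
  pd i (fun p => a * f p) = (fun p => a * pd i f p).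
Proof.
move=> hf; rewrite (pdM i (smooth_cst a) hf).
by rewrite pd_cst; apply/funext => p; rewrite mul0r add0r.
Qed.

Lemma pdN f i : smooth_on setT f -> pd i (fun p => - f p) = (fun p => - pd i f p).
Proof. by move=> hf; apply: pdE => p; apply: is_deriveN; apply: is_derive_pd. Qed.

Lemma pdB f g i : smooth_on setT f -> smooth_on setT g ->
  pd i (fun p => f p - g p) = (fun p => pd i f p - pd i g p).
Proof. by move=> hf hg; rewrite (pdD i hf (smooth_opp hg)) (pdN i hg). Qed.

End Smooth.

(** * Square integrable functions on the unit disk *)

Section Meas.
Variable R : realType.
Implicit Types (f g : R * R -> R) (p v : R * R) (i j : 'I_2).

(* The Borel sets of the line carry two displays; the product measure lives on this
   one, and the two notions of measurability are convertible. *)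
Local Notation T1 := (g_sigma_algebraType R.-ocitv.-measurable).
Local Notation T2 := (T1 * T1)%type.
Local Notation mfun D f := (@measurable_fun _ _ T2 R D f).

Definition box (a b c : R) : set (R * R) := `]a - c, a + c[ `*` `]b - c, b + c[.

Lemma boxE a b c p : box a b c p <-> `|p.1 - a| < c /\ `|p.2 - b| < c.
Proof.
rewrite /box /= !in_itv /=; split.
  move=> [/andP[h1 h2] /andP[h3 h4]]; rewrite !ltr_norml; split; apply/andP; split; lra.
rewrite !ltr_norml => -[/andP[h1 h2] /andP[h3 h4]]; split; apply/andP; split; lra.
Qed.

Lemma measurable_box (a b c : R) : measurable (box a b c : set T2).
Proof. by apply: measurableX; apply: measurable_itv. Qed.

Lemma open_square (U : set (R * R)) p : open U -> U p ->
  exists2 e : R, 0 < e & forall q, `|q.1 - p.1| < e -> `|q.2 - p.2| < e -> U q.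
Proof.
move=> oU Up; have : nbhs p U by exact: open_nbhs_nbhs.
rewrite -nbhs_ballE => -[e /= e0 he]; exists e => // q h1 h2; apply: he.
by split; rewrite /= /ball /= distrC.
Qed.

(** Every open set is a countable union of squares with rational centres and
    sizes, and squares are rectangles of the product sigma-algebra. *)
Lemma open_measurable2 (U : set (R * R)) : open U -> measurable (U : set T2).
Proof.
move=> oU.
pose F (a b c : rat) : set (R * R) :=
  if pselect (box (ratr a) (ratr b) (ratr c) `<=` U) then
    box (ratr a) (ratr b) (ratr c) else set0.
have -> : U = \bigcup_a \bigcup_b \bigcup_c F a b c.
  apply/seteqP; split=> [p Up|p [a _ [b _ [c _]]]]; last first.
    by rewrite /F; case: pselect => // h /h.
  have [e e0 he] := open_square oU Up.
  have [c hc] := rat_in_itvoo (divr_gt0 e0 (ltr0Sn R 1)).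
  move: hc; rewrite in_itv /= => /andP[c0 c1].
  have near (t : R) : exists a : rat, t - ratr c < ratr a < t + ratr c.
    have /rat_in_itvoo[a] : t - ratr c < t + ratr c by lra.
    by rewrite in_itv /=; exists a.
  have [a /andP[a0 a1]] := near p.1; have [b /andP[b0 b1]] := near p.2.
  exists a => //; exists b => //; exists c => //; rewrite /F.
  case: pselect => [h|[]] /=.
    by apply/boxE; rewrite !ltr_norml; split; apply/andP; split; lra.
  move=> q /boxE; rewrite !ltr_norml => -[/andP[h1 h2] /andP[h3 h4]].
  by apply: he; rewrite ltr_norml; apply/andP; split; lra.
apply: bigcupT_measurable_rat => a; apply: bigcupT_measurable_rat => b.
apply: bigcupT_measurable_rat => c.
by rewrite /F; case: pselect => [h|h]; [exact: measurable_box|exact: measurable0].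
Qed.

Lemma continuous_measurable2 f D : measurable (D : set T2) -> continuous f -> mfun D f.
Proof.
move=> mD cf; apply: measurable_funS (subsetT _) _ => //.
apply: (measurability _ (measurable_realfun.RGenOInfty.measurableE R)).
move=> /= _ [_ [a ->]] <-; apply: measurableI => //.
apply: open_measurable2; apply: open_comp; last exact: interval_open.
by move=> x _; exact: cf.
Qed.

Definition sqn p : R := p.1 ^+ 2 + p.2 ^+ 2.

Lemma smooth_sqn : smooth_on setT sqn.
Proof. by apply: smooth_add; apply: smooth_sqr; [exact: smooth_fst|exact: smooth_snd]. Qed.

Lemma diskE : disk (0, 0) 1 = [set p | sqn p < 1].
Proof. by apply/funext => p; rewrite /disk /sqn /= !subr0 expr1n. Qed.

Lemma disk_open : open (disk ((0:R), (0:R)) 1).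
Proof.
rewrite diskE; have := @open_comp _ _ sqn [set x : R | x < 1].
by apply; [move=> p _; exact: (smooth_cont smooth_sqn)|exact: open_lt].
Qed.

Definition cdisk : set (R * R) := [set p | sqn p <= 1].

Lemma closed_sublevel f a : continuous f -> closed [set p | f p <= a].
Proof.
move=> cf; have := @closed_comp _ _ f [set x : R | x <= a].
by apply; [move=> p _; exact: cf|exact: closed_le].
Qed.

Lemma sqn_bound (a : R) p : 0 <= a -> sqn p <= a ^+ 2 -> -a <= p.1 <= a /\ - a <= p.2 <= a.
Proof.
rewrite /sqn => a0 h; have := sqr_ge0 p.1; have := sqr_ge0 p.2 => h1 h2.
by rewrite -!ler_norml -!(ler_sqr (normr_ge0 _)) ?nnegrE// !real_normK ?num_real//; split; lra.
Qed.

Lemma cdisk_compact : compact cdisk.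
Proof.
apply: (@subclosed_compact _ _ ((`[-1, 1]%classic : set R) `*` (`[-1, 1]%classic : set R))).
- exact: closed_sublevel (smooth_cont smooth_sqn).
- by apply: compact_setX; exact: segment_compact.
move=> p; rewrite /cdisk /= -[1 in X in X -> _](expr1n R 2) => /(sqn_bound ler01) [h1 h2].
by rewrite /= !in_itv.
Qed.

Lemma continuous_bounded_disk f : continuous f -> exists2 M : R, 0 < M & forall p, sqn p <= 1 -> `|f p| <= M.
Proof.
move=> cf.
have [] := @compact_EVT_max _ R (fun p => `|f p|) cdisk _ cdisk_compact.
- by exists (0, 0); rewrite /cdisk /= /sqn /= expr0n /= addr0.
- by apply: continuous_subspaceT => p; apply: cvg_norm; exact: cf.
move=> c _ h; exists (`|f c| + 1); first by have := normr_ge0 (f c); lra.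
by move=> p hp; have := h p; rewrite inE => /(_ hp); lra.
Qed.

Local Notation B := (disk ((0:R), (0:R)) 1).
Local Notation mu := (@leb2 R).

Lemma measurable_disk : measurable (B : set T2). Proof. exact: open_measurable2 disk_open. Qed.

Lemma leb2_box (a b c : R) : 0 <= c -> mu (box a b c) = ((2 * c) ^+ 2)%:E.
Proof.
move=> c0; rewrite /leb2 /box product_measure1E; [|exact: measurable_itv..].
have h (x : R) : lebesgue_measure `]x - c, x + c[ = (2 * c)%:E.
  rewrite lebesgue_measure_itv /= lte_fin.
  case: ifPn => [_|]; first by rewrite -EFinB; congr EFin; ring.
  by rewrite -leNgt => h; congr EFin; lra.
by have := h a; have := h b => /= -> ->; rewrite -EFinM expr2.
Qed.

Lemma leb2_disk_fin : (mu B < +oo)%E.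
Proof.
apply: (@le_lt_trans _ _ (mu (box 0 0 2))); last by rewrite leb2_box ?ltry.
apply: le_measure; rewrite ?inE; [exact: measurable_disk|exact: measurable_box|].
rewrite diskE => p /= /ltW hq; apply/boxE.
have [|] := @sqn_bound 1 p ler01; first by rewrite expr1n.
by rewrite !subr0 !ltr_norml => /andP[? ?] /andP[? ?]; split; apply/andP; split; lra.
Qed.

Definition disk_integrable f := mu.-integrable B (EFin \o f).

Lemma intg_bounded f M : mfun B f -> (forall p, B p -> `|f p| <= M) -> disk_integrable f.
Proof.
move=> mf hM; apply: measurable_bounded_integrable => //; [exact: measurable_disk|exact: leb2_disk_fin|].
exists M; split; first exact: num_real.
by move=> x /ltW Mx p /= /hM; move/le_trans; apply.
Qed.

Lemma intg_cont f : continuous f -> disk_integrable f.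
Proof.
move=> cf; have [M _ hM] := continuous_bounded_disk cf.
apply: (@intg_bounded _ M); first exact: continuous_measurable2 measurable_disk cf.
by move=> p; rewrite diskE => /ltW /hM.
Qed.

Lemma intgD f g : disk_integrable f -> disk_integrable g -> disk_integrable (fun p => f p + g p).
Proof.
move=> hf hg; exact: (integrableD measurable_disk hf hg).
Qed.

Lemma intgZ (a : R) f : disk_integrable f -> disk_integrable (fun p => a * f p).
Proof.
move=> hf; exact: (integrableZl measurable_disk a hf).
Qed.

Lemma intgN f : disk_integrable f -> disk_integrable (fun p => - f p).
Proof.
move=> hf; exact: (integrableN hf).
Qed.

Lemma intgB f g : disk_integrable f -> disk_integrable g -> disk_integrable (fun p => f p - g p).
Proof. by move=> hf hg; apply: intgD; [|exact: intgN]. Qed.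

Lemma L2_sqr f : L2 B f -> disk_integrable (fun p => f p ^+ 2).
Proof.
move=> [mf hf]; apply/integrableP; split.
  by apply/measurable_realfun.measurable_EFinP; apply: measurable_realfun.measurable_funX.
by under eq_integral do rewrite /= ger0_norm ?sqr_ge0//.
Qed.

Lemma sqr_L2 f : mfun B f -> disk_integrable (fun p => f p ^+ 2) -> L2 B f.
Proof.
move=> mf /integrableP[_ h]; split=> //; apply: le_lt_trans h.
by under [leRHS]eq_integral do rewrite /= ger0_norm ?sqr_ge0//.
Qed.

Lemma intg_le f g : mfun B f -> disk_integrable g -> (forall p, B p -> `|f p| <= g p) -> disk_integrable f.
Proof.
move=> mf hg h; apply: (le_integrable measurable_disk _ _ hg); first exact/measurable_realfun.measurable_EFinP.
by move=> p Bp /=; rewrite lee_fin (le_trans (h p Bp))// ler_norm.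
Qed.

Lemma L2_mul f g : L2 B f -> L2 B g -> disk_integrable (fun p => f p * g p).
Proof.
move=> hf hg; apply: (@intg_le _ (fun p => f p ^+ 2 + g p ^+ 2)).
- by apply: measurable_realfun.measurable_funM; [exact: hf.1|exact: hg.1].
- by apply: intgD; exact: L2_sqr.
- move=> p _; rewrite ler_norml; apply/andP; split.
    have := sqr_ge0 (f p + g p); have := sqr_ge0 (f p); have := sqr_ge0 (g p); nra.
  have := sqr_ge0 (f p - g p); have := sqr_ge0 (f p); have := sqr_ge0 (g p); nra.
Qed.

Lemma L2D f g : L2 B f -> L2 B g -> L2 B (fun p => f p + g p).
Proof.
move=> hf hg; apply: sqr_L2; first by apply: measurable_realfun.measurable_funD; [exact: hf.1|exact: hg.1].
have -> : (fun p => (f p + g p) ^+ 2) = (fun p => f p ^+ 2 + (2 * (f p * g p) + g p ^+ 2)).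
  by apply/funext => p; ring.
by apply: intgD; [exact: L2_sqr|apply: intgD; [apply: intgZ; exact: L2_mul|exact: L2_sqr]].
Qed.

Lemma L2Z (a : R) f : L2 B f -> L2 B (fun p => a * f p).
Proof.
move=> hf; apply: sqr_L2; first by apply: measurable_realfun.measurable_funM; [exact: measurable_cst|exact: hf.1].
have -> : (fun p => (a * f p) ^+ 2) = (fun p => a ^+ 2 * f p ^+ 2).
  by apply/funext => p; ring.
by apply: intgZ; exact: L2_sqr.
Qed.

Lemma L2B f g : L2 B f -> L2 B g -> L2 B (fun p => f p - g p).
Proof.
move=> hf hg; have -> : (fun p => f p - g p) = (fun p => f p + (-1) * g p).
  by apply/funext => p; ring.
by apply: L2D => //; exact: L2Z.
Qed.

Lemma L2_cont f : continuous f -> L2 B f.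
Proof.
move=> cf; apply: sqr_L2; first exact: continuous_measurable2 measurable_disk cf.
by apply: intg_cont => p; apply: cvgM; exact: cf.
Qed.

(** Named so that linearity rewrites without repeating the measurability of the
    disk. *)
Definition Int f : R := \int[mu]_(p in B) f p.

Lemma IntD f g : disk_integrable f -> disk_integrable g -> Int (fun p => f p + g p) = Int f + Int g.
Proof. exact: RintegralD measurable_disk. Qed.
Lemma IntB f g : disk_integrable f -> disk_integrable g -> Int (fun p => f p - g p) = Int f - Int g.
Proof. exact: RintegralB measurable_disk. Qed.
Lemma IntZ (a : R) f : disk_integrable f -> Int (fun p => a * f p) = a * Int f.
Proof. by move=> hf; exact: (RintegralZl a measurable_disk hf). Qed.
Lemma le_Int f g : disk_integrable f -> disk_integrable g -> (forall p, B p -> f p <= g p) -> Int f <= Int g.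
Proof. exact: le_Rintegral measurable_disk. Qed.
Lemma Int_ge0 f : (forall p, B p -> 0 <= f p) -> 0 <= Int f.
Proof. by move=> h; apply: fine_ge0; apply: integral_ge0 => p Bp; rewrite lee_fin h. Qed.
Lemma EFin_Int f : disk_integrable f -> (\int[mu]_(p in B) (f p)%:E)%E = (Int f)%:E.
Proof. by move=> hf; rewrite /Int /Rintegral fineK//; exact: (integrable_fin_num measurable_disk hf). Qed.
Lemma eq_Int f g : (forall p, B p -> f p = g p) -> Int f = Int g.
Proof. by move=> h; apply: eq_Rintegral => p; rewrite inE => /h. Qed.

Lemma ae_zero f : mfun B f -> disk_integrable (fun p => f p ^+ 2) -> Int (fun p => f p ^+ 2) = 0 ->
  {ae mu, forall p, B p -> f p = 0}.
Proof.
move=> mf hf h0; have h1 : (\int[mu]_(p in B) `|((f p) ^+ 2)%:E|)%E = 0%E.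
  by under eq_integral do rewrite /= ger0_norm ?sqr_ge0//; rewrite EFin_Int// h0.
have mf2 : mfun B (fun p => f p ^+ 2) by apply: measurable_realfun.measurable_funX.
have /(ae_eq_integral_abs mu measurable_disk) := proj2 (measurable_realfun.measurable_EFinP _ _) mf2.
move=> /iffLR /(_ h1); apply: filterS => p h Bp.
by have /= := h Bp => -[] /eqP; rewrite sqrf_eq0 => /eqP.
Qed.

End Meas.

(** * Integration by parts and the Poincare inequality *)

Section IBP.
Variable R : realType.
Implicit Types (f g : R * R -> R) (p v : R * R) (i j : 'I_2).
Local Notation B := (disk ((0:R), (0:R)) 1).
Local Notation mu := (@leb2 R).

Lemma ord2P i : i = 0 \/ i = 1.
Proof. by case: i => -[|[|//]] h; [left|right]; apply/val_inj. Qed.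

Lemma sum_ord2 (F : 'I_2 -> R) : \sum_(j < 2) F j = F 0 + F 1.
Proof.
rewrite !big_ord_recl big_ord0 addr0; congr (_ + F _); exact/val_inj.
Qed.

Lemma is_derive_axis1 f y t : smooth_on setT f ->
  is_derive (t : R) (1 : R) (fun s => f (s, y)) (pd 0 f (t, y)).
Proof.
move=> sf; have -> : (fun s => f (s, y)) = (fun s : R => f ((0, y) + s *: basis2 R 0)).
  apply/funext => s; congr f; rewrite /basis2 eqxx; congr pair => /=.
    by rewrite /GRing.scale /= mulr1 add0r.
  by rewrite /GRing.scale /= mulr0 addr0.
have E : (0, y) + t *: basis2 R 0 = (t, y).
  by congr pair; rewrite /= /GRing.scale /= ?mulr1 ?mulr0 ?add0r ?addr0.
split; first by rewrite derivable_line; exact: smooth_deriv.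
by rewrite derive_line E.
Qed.

Lemma is_derive_axis2 f x t : smooth_on setT f ->
  is_derive (t : R) (1 : R) (fun s => f (x, s)) (pd 1 f (x, t)).
Proof.
move=> sf; have -> : (fun s => f (x, s)) = (fun s : R => f ((x, 0) + s *: basis2 R 1)).
  apply/funext => s; congr f; congr pair => /=.
    by rewrite /GRing.scale /= mulr0 addr0.
  by rewrite /GRing.scale /= mulr1 add0r.
have E : (x, 0) + t *: basis2 R 1 = (x, t).
  by congr pair; rewrite /= /GRing.scale /= ?mulr1 ?mulr0 ?add0r ?addr0.
split; first by rewrite derivable_line; exact: smooth_deriv.
by rewrite derive_line E.
Qed.

Definition supp f : set (R * R) := closure [set p | f p != 0].

Lemma nsupp_near f p : ~ supp f p -> \forall q \near p, f q = 0.
Proof.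
move=> h; have o : open (~` supp f) by apply: closed_openC; exact: closed_closure.
have : nbhs p (~` supp f) by exact: open_nbhs_nbhs.
apply: filterS => q nq; apply/eqP; apply: contrapT => /negP fq.
by apply: nq; exact: subset_closure.
Qed.

Lemma nsupp0 f p : ~ supp f p -> f p = 0.
Proof. by move=> /nsupp_near /nbhs_singleton. Qed.

Lemma nsupp_pd f p i : ~ supp f p -> pd i f p = 0.
Proof.
move=> /nsupp_near h; rewrite /pd (@near_eq_derive _ _ _ f (fun=> 0))//.
exact: derive_cst.
Qed.

Lemma test_smooth f : test_fun B f -> smooth_on setT f.
Proof. by case. Qed.

Lemma test0 f p : test_fun B f -> ~ B p -> f p = 0.
Proof. by move=> [_ _ h] nB; apply: nsupp0 => /h. Qed.

Lemma test_pd0 f p i : test_fun B f -> ~ B p -> pd i f p = 0.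
Proof. by move=> [_ _ h] nB; apply: nsupp_pd => /h. Qed.

Lemma test_sub f g : test_fun B f -> smooth_on setT g ->
  (forall p, g p != 0 -> supp f p) -> test_fun B g.
Proof.
move=> [_ h2 h3] sg h.
have h' : supp g `<=` supp f.
  by rewrite /supp [X in _ `<=` X](_ : _ = closure (supp f)) ?closure_id//;
     [apply: closure_subset => p /= /h|rewrite -closure_id//; exact: closed_closure].
split; [exact: sg| |by move=> p /h' /h3].
by apply: (subclosed_compact _ h2 h'); exact: closed_closure.
Qed.

Lemma test_pd f i : test_fun B f -> test_fun B (pd i f).
Proof.
move=> tf; apply: (test_sub tf); first exact: smooth_pd (test_smooth tf).
by move=> p /eqP; apply: contra_notP => /nsupp_pd.
Qed.

Lemma test_mulr f g : smooth_on setT g -> test_fun B f -> test_fun B (fun p => g p * f p).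
Proof.
move=> sg tf; apply: (test_sub tf); first exact: smooth_mul sg (test_smooth tf).
by move=> p; rewrite mulf_eq0 negb_or => /andP[_ h]; exact: subset_closure.
Qed.

Lemma test_add f g : test_fun B f -> test_fun B g -> test_fun B (fun p => f p + g p).
Proof.
move=> [f1 f2 f3] [g1 g2 g3].
have h : supp (fun p => f p + g p) `<=` supp f `|` supp g.
  rewrite /supp -closureU; apply: closure_subset => p /=.
  by have [->|? _] := eqVneq (f p) 0; [rewrite add0r; right|left].
split; first exact: smooth_add f1 g1.
  by apply: (subclosed_compact _ (compactU f2 g2) h); exact: closed_closure.
by move=> p /h [/f3|/g3].
Qed.

(** The fundamental theorem of calculus on [[-2, 2]], an interval that
    contains the projections of the disk in its interior. *)
Lemma integral_derivative0 (g dg : R -> R) : (forall t, is_derive (t : R) (1 : R) g (dg t)) ->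
  continuous dg -> (forall t, 2 <= `|t| -> g t = 0 /\ dg t = 0) ->
  (\int[@lebesgue_measure R]_t (dg t)%:E = 0)%E.
Proof.
move=> hg cdg h0.
have d t : derivable g t 1 by have [] := hg t.
have c t : {for t, continuous g}.
  by apply: differentiable_continuous; exact/derivable1_diffP.
have -> : (\int[@lebesgue_measure R]_t (dg t)%:E =
  \int[@lebesgue_measure R]_(t in `[(- (2%R : R))%R, (2%R : R)]) (dg t)%:E)%E.
  rewrite [RHS]integral_mkcond; apply: eq_integral => t _.
  rewrite patchE; case: ifPn => // /negP; rewrite inE /= in_itv /= => ht.
  rewrite (h0 t _).2//; apply: contrapT => /negP; rewrite -ltNge ltr_norml => /andP[t1 t2].
  by apply: ht; rewrite !ltW.
rewrite (@continuous_FTC2 _ dg g); first last.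
- by move=> t _; rewrite derive1E; apply: derive_val.
- split; first by move=> t _; exact: d.
    by apply: cvg_at_right_filter; exact: c.
  by apply: cvg_at_left_filter; exact: c.
- exact: continuous_subspaceT.
- lra.
have n2 : 2 <= `|2 : R| by rewrite ler_normr lexx.
have n2' : 2 <= `|- 2 : R| by rewrite normrN.
by rewrite (h0 _ n2).1 (h0 _ n2').1 subee.
Qed.

Lemma far_notin_disk (x y : R) : 2 <= `|x| \/ 2 <= `|y| -> ~ B (x, y).
Proof.
rewrite diskE /sqn /= => h hq.
suff : 4 <= x ^+ 2 \/ 4 <= y ^+ 2.
  have := sqr_ge0 x; have := sqr_ge0 y; lra.
case: h => h; [left|right].
  rewrite -(real_normK (num_real x)); nra.
rewrite -(real_normK (num_real y)); nra.
Qed.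

Lemma intg_setT f : continuous f -> (forall p, ~ B p -> f p = 0) ->
  mu.-integrable setT (EFin \o f) /\ (\int[mu]_p (f p)%:E)%E = (Int f)%:E.
Proof.
move=> cf f0; have h : (EFin \o f) \_ B = EFin \o f.
  apply/funext => p; rewrite patchE; case: ifPn => // /negP nB.
  by rewrite /= f0// => Bp; apply: nB; rewrite inE.
have hB := intg_cont cf; split.
  by move: hB; rewrite /disk_integrable => /(integrable_mkcond _ (@measurable_disk R)); rewrite h.
by rewrite -EFin_Int// [in RHS]integral_mkcond h.
Qed.

Lemma continuous_pairl (x : R) : continuous (fun t : R => (t, x)).
Proof.
move=> t; have h1 : s @[s --> t] --> t by exact: cvg_id.
have h2 : (fun=> x) s @[s --> t] --> x by exact: cvg_cst.
by have := cvg_pair h1 h2; apply.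
Qed.

Lemma continuous_pairr (x : R) : continuous (fun t : R => (x, t)).
Proof.
move=> t; have h1 : s @[s --> t] --> t by exact: cvg_id.
have h2 : (fun=> x) s @[s --> t] --> x by exact: cvg_cst.
by have := cvg_pair h2 h1; apply.
Qed.

(** The derivative vanishes outside the disk, so the integral is over the plane;
    by Fubini it may be computed along the lines of direction [i], where the fundamental
    theorem of calculus gives zero. *)
Lemma Int_pd_eq0 f i : test_fun B f -> Int (pd i f) = 0.
Proof.
move=> tf; have sf := test_smooth tf.
have cf := smooth_cont (smooth_pd i sf).
have [h1 h2] := intg_setT cf (fun p => test_pd0 i tf).
apply: EFin_inj; rewrite -h2.
have cc (x : R) : continuous (fun t : R => (t, x)) := @continuous_pairl x.
have cc' (x : R) : continuous (fun t : R => (x, t)) := @continuous_pairr x.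
case: (ord2P i) => ei; subst i.
- rewrite -(integral21_prod_meas1 h1); apply: integral0_eq => y _; rewrite /fubini_G.
  apply: (@integral_derivative0 (fun t => f (t, y)) (fun t => pd 0 f (t, y))).
  + by move=> t; exact: is_derive_axis1.
  + by move=> t; apply: continuous_comp; [exact: cc|exact: cf].
  + by move=> t ht; rewrite (test0 tf) ?(test_pd0 _ tf)//; apply: far_notin_disk; left.
- rewrite -(integral12_prod_meas1 h1); apply: integral0_eq => x _; rewrite /fubini_F.
  apply: (@integral_derivative0 (fun t => f (x, t)) (fun t => pd 1 f (x, t))).
  + by move=> t; exact: is_derive_axis2.
  + by move=> t; apply: continuous_comp; [exact: cc'|exact: cf].
  + by move=> t ht; rewrite (test0 tf) ?(test_pd0 _ tf)//; apply: far_notin_disk; right.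
Qed.

Lemma intg_smooth f : smooth_on setT f -> disk_integrable f.
Proof. by move=> /smooth_cont /intg_cont. Qed.

Lemma L2_smooth f : smooth_on setT f -> L2 B f.
Proof. by move=> /smooth_cont /L2_cont. Qed.

(** The integral of [pd i (f * g)] is zero since [f * g] is a test function. *)
Lemma Int_by_parts f g i : smooth_on setT f -> test_fun B g ->
  Int (fun p => f p * pd i g p) = - Int (fun p => pd i f p * g p).
Proof.
move=> sf tg; have sg := test_smooth tg.
have := Int_pd_eq0 i (test_mulr sf tg); rewrite (pdM i sf sg) IntD; first lra.
  by apply: intg_smooth; apply: smooth_mul; [exact: smooth_pd|exact: sg].
by apply: intg_smooth; apply: smooth_mul; [exact: sf|exact: smooth_pd].
Qed.

Lemma W12_grad_smooth f : smooth_on setT f -> W12_grad B f (fun i => pd i f).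
Proof.
move=> sf; split; first exact: L2_smooth.
move=> i; split; first by apply: L2_smooth; exact: smooth_pd.
by move=> g tg; exact: Int_by_parts.
Qed.

(** Integrating by parts with the coordinate [x] of direction [i] gives
    [Int (f ^+ 2) = - Int (2 * x * f * pd i f)], and [`|x| <= 1] on the disk lets the
    right side be absorbed. *)
Lemma Poincare_test f i : test_fun B f ->
  Int (fun p => f p ^+ 2) <= 4 * Int (fun p => pd i f p ^+ 2).
Proof.
move=> tf; have sf := test_smooth tf; have sdf := smooth_pd i sf.
have [x [sx dx bx]] : exists x : R * R -> R,
    [/\ smooth_on setT x, pd i x = (fun=> 1) & forall p, B p -> x p ^+ 2 <= 1].
  case: (ord2P i) => ->.
    exists fst; split; [exact: smooth_fst|by rewrite pd_fst|].
    by rewrite diskE => p; rewrite /sqn /= => h; have := sqr_ge0 p.2; lra.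
  exists snd; split; [exact: smooth_snd|by rewrite pd_snd|].
  by rewrite diskE => p; rewrite /sqn /= => h; have := sqr_ge0 p.1; lra.
have i1 : disk_integrable (fun p => f p ^+ 2) by apply: intg_smooth; exact: smooth_sqr.
have i2 : disk_integrable (fun p => pd i f p ^+ 2) by apply: intg_smooth; exact: smooth_sqr.
have tx : test_fun B (fun p => f p * f p) by exact: test_mulr.
have := Int_by_parts i sx tx; rewrite dx (pdM i sf sf).
have -> : Int (fun p => 1 * (f p * f p)) = Int (fun p => f p ^+ 2).
  by apply: eq_Int => p _; ring.
move=> e.
(* Weights that leave half of [f ^+ 2] on the left after absorbing. *)
have : Int (fun p => - (1 / 2) * f p ^+ 2 + (-2) * pd i f p ^+ 2) <=
    Int (fun p => x p * (pd i f p * f p + f p * pd i f p)).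
  apply: le_Int.
  - by apply: intgD; exact: intgZ.
  - by apply: intg_smooth; apply: (smooth_mul sx); apply: smooth_add; apply: smooth_mul.
  move=> p /bx hx; have := sqr_ge0 (f p + 2 * x p * pd i f p).
  have := sqr_ge0 (pd i f p); nra.
by rewrite e IntD ?IntZ//; [lra|exact: intgZ|exact: intgZ].
Qed.

End IBP.

(** * A smooth flat function *)

Section Cutoff.
Variable R : realType.
Implicit Types (f g : R * R -> R) (p v : R * R) (i j : 'I_2).
Local Notation B := (disk ((0:R), (0:R)) 1).
Local Notation mu := (@leb2 R).

(** The function [exp (- 1 / t)] extended by zero is [flat 0]; the other members
    are there because the family is closed under differentiation up to linear
    combinations, whence the smoothness of all of them. *)
Definition flat m (t : R) : R := if 0 < t then (t^-1) ^+ m * expR (- t^-1) else 0.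

Lemma flat_pos m t : 0 < t -> flat m t = (t^-1) ^+ m * expR (- t^-1).
Proof. by rewrite /flat => ->. Qed.

Lemma flat_npos m t : t <= 0 -> flat m t = 0.
Proof. by rewrite /flat ltNge => ->. Qed.

Lemma flat_ge0 m t : 0 <= flat m t.
Proof.
rewrite /flat; case: ifPn => // t0.
by rewrite mulr_ge0 ?expR_ge0// exprn_ge0// invr_ge0 ltW.
Qed.

(** With [x = 1 / t] this is the bound of [expR x] below by a term of its series. *)
Lemma flat_le_fact m t : flat m t <= m`!%:R.
Proof.
rewrite /flat; case: ifPn => // t0; rewrite expRN ler_pdivrMr ?expR_gt0//.
have x0 : 0 <= t^-1 by rewrite invr_ge0 ltW.
case: m => [|m].
  by rewrite expr0 fact0 mul1r (le_trans _ (expR_ge1Dx _))// lerDl.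
have := expR_ge1Dxn m x0 => h.
have f0 : (0 : R) < (m.+1)`!%:R by rewrite ltr0n fact_gt0.
rewrite -ler_pdivrMl// mulrC; lra.
Qed.

Lemma flat_le_invX m t : 0 < t -> flat m t <= (t^-1) ^+ m.
Proof.
move=> t0; rewrite flat_pos// ler_piMr ?exprn_ge0 ?invr_ge0 ?ltW//.
by rewrite -[ltRHS]expR0 ltr_expR oppr_lt0 invr_gt0.
Qed.

Lemma mul_flatS m t : t * flat m.+1 t = flat m t.
Proof.
rewrite /flat; case: ifPn => [t0|]; last by rewrite mulr0.
by rewrite exprS !mulrA mulfV ?mul1r ?gt_eqF.
Qed.

Lemma inv_mul_flat m t : t^-1 * flat m t = flat m.+1 t.
Proof.
have [->|t0] := eqVneq t 0; first by rewrite invr0 mul0r flat_npos.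
by rewrite -mul_flatS mulKf.
Qed.

Lemma norm_flat_le m t : `|flat m t| <= (m.+1)`!%:R * `|t|.
Proof.
by rewrite -mul_flatS normrM mulrC ler_wpM2r// (ger0_norm (flat_ge0 _ _)) flat_le_fact.
Qed.

Lemma flat_cvg0 m : flat m t @[t --> 0] --> 0.
Proof.
have F0 : (0 : R) < (m.+1)`!%:R by rewrite ltr0n fact_gt0.
apply/cvgrPdist_lt => e e0.
have d0 : 0 < e / (m.+1)`!%:R by rewrite divr_gt0.
near=> t.
rewrite sub0r normrN (le_lt_trans (norm_flat_le m t))// mulrC -ltr_pdivlMr//.
Unshelve. all: by end_near. Qed.

(** At [0] the difference quotient of [flat m] is exactly [flat m.+1],
    which tends to zero. *)
Lemma is_derive_flat m t :
  is_derive (t : R) (1 : R) (flat m) (- m%:R * flat m.+1 t + flat m.+2 t).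
Proof.
have [t0|t0|<-] := ltgtP 0 t.
- have E : \forall s \near t, flat m s = (s^-1) ^+ m * expR (- s^-1).
    near=> s; apply: flat_pos; near: s; exact: lt_nbhsr.
  have D : is_derive (t : R) (1 : R) (fun s : R => (s^-1) ^+ m * expR (- s^-1))
      (- m%:R * flat m.+1 t + flat m.+2 t).
    have tn0 : t != 0 by rewrite gt_eqF.
    have Dv : is_derive (t : R) (1 : R) (fun s : R => s^-1) (- (t^-1) ^+ 2).
      have := @is_deriveV R id t 1 1 tn0 (is_derive_id _ _).
      by move=> /is_derive_eq; apply; rewrite /GRing.scale /= mulr1 exprVn.
    have D1 := is_deriveX m Dv; rewrite exprfctE in D1.
    have Dn : is_derive (t : R) (1 : R) (fun s : R => - s^-1) ((t^-1) ^+ 2).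
      by have := is_deriveN Dv => /is_derive_eq; apply; rewrite opprK.
    have D2 := @is_derive1_comp R expR (fun s : R => - s^-1) t _ _ (is_derive_expR _) Dn.
    have := is_deriveM D1 D2; rewrite mulrfctE.
    move=> /is_derive_eq; apply; rewrite !flat_pos//.
    rewrite /GRing.scale /=.
    case: m {E D1} => [|m]; rewrite ?exprS /=; first by rewrite !expr0; ring.
    by ring.
  split; first by apply: near_eq_derivable; [|case: D => h _; exact: h]; near do apply/esym.
  by rewrite (near_eq_derive _ E); apply: derive_val.
- have E : \forall s \near t, flat m s = 0.
    near=> s; apply: flat_npos; apply: ltW; near: s; exact: lt_nbhsl.
  have -> : - m%:R * flat m.+1 t + flat m.+2 t = 0.
    by rewrite !flat_npos ?ltW// mulr0 addr0.
  split; first by apply: (@near_eq_derivable _ _ _ (fun=> 0)); [near do apply/esym|exact: derivable_cst].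
  by rewrite (near_eq_derive _ E) derive_cst.
- rewrite !flat_npos// mulr0 addr0.
  have E : (fun h : R => h^-1 *: ((flat m \o shift 0) (h *: 1) - flat m 0)) = flat m.+1.
    apply/funext => h; rewrite -inv_mul_flat (@flat_npos m 0)// subr0 /= addr0.
    by rewrite /GRing.scale /= mulr1.
  have C : flat m.+1 h @[h --> 0^'] --> 0.
    by apply: cvg_trans (flat_cvg0 m.+1); apply: cvg_app; exact: nbhs_dnbhs.
  split; first by rewrite /derivable E; apply/cvg_ex; exists 0.
  by rewrite /derive E; apply: cvg_lim C.
Unshelve. all: by end_near. Qed.

Lemma flat_continuous m : continuous (flat m).
Proof.
move=> t; apply: differentiable_continuous; apply/derivable1_diffP.
by have [] := is_derive_flat m t.
Qed.

Lemma pderivable_flat m f : pderivable f -> pderivable (fun p => flat m (f p)).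
Proof.
move=> cf; have [c d] := cf; split.
  by move=> p; apply: continuous_comp; [exact: c|exact: flat_continuous].
move=> p i; have [] := is_derive_comp (pderivable_is_derive cf p i) (is_derive_flat m (f p)).
by [].
Qed.

Lemma pd_flatm m f i : pderivable f -> pd i (fun p => flat m (f p)) =
  (fun p => (- m%:R * flat m.+1 (f p) + flat m.+2 (f p)) * pd i f p).
Proof.
move=> cf; apply: pdE => p.
exact: (is_derive_comp (pderivable_is_derive cf p i) (is_derive_flat m (f p))).
Qed.

Lemma smooth_upto_cst n (a : R) : smooth_upto n (fun _ : R * R => a).
Proof. by have /smooth_uptoP := smooth_cst a; apply. Qed.

(** All indices [m] are treated at once, since differentiating raises [m]. *)
Lemma smooth_upto_flat n m f : smooth_upto n f -> smooth_upto n (fun p => flat m (f p)).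
Proof.
elim: n m f => [|n IH] m f.
  by move=> [h _]; split; [exact: pderivable_flat|].
move=> hf; have [cf df] := hf; split; first exact: pderivable_flat.
move=> i; rewrite (pd_flatm m i cf).
apply: smooth_uptoM; last exact: df.
apply: smooth_uptoD; last by apply: IH; exact: smooth_uptoS.
by apply: smooth_uptoM; [exact: smooth_upto_cst|apply: IH; exact: smooth_uptoS].
Qed.

Lemma smooth_flat m f : smooth_on setT f -> smooth_on setT (fun p => flat m (f p)).
Proof. by move=> /smooth_uptoP h; apply/smooth_uptoP => n; exact: smooth_upto_flat. Qed.

Lemma smooth_pderivable f : smooth_on setT f -> pderivable f.
Proof. by move=> /smooth_uptoP /(_ 0%N) []. Qed.

Lemma pd_flat0 f i : smooth_on setT f ->
  pd i (fun p => flat 0 (f p)) = (fun p => flat 2 (f p) * pd i f p).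
Proof.
move=> sf; rewrite (pd_flatm 0 i (smooth_pderivable sf)); apply/funext => p.
by rewrite oppr0 mul0r add0r.
Qed.

End Cutoff.

(** * Cutting off functions that vanish on the circle *)

Section Approx.
Variable R : realType.
Implicit Types (f g : R * R -> R) (p v : R * R) (i j : 'I_2).
Local Notation B := (disk ((0:R), (0:R)) 1).
Local Notation mu := (@leb2 R).

(** The mean value theorem on the part of the chord between [x] and the nearer
    endpoint, whose length is at most [2 * (a ^+ 2 - x ^+ 2)] as [a] is at least [1 / 2]. *)
Lemma chord_bound (g dg : R -> R) (M a x : R) :
  (forall t, is_derive (t : R) (1 : R) g (dg t)) ->
  (forall t, t ^+ 2 <= a ^+ 2 -> `|dg t| <= M) ->
  1 / 2 <= a -> g a = 0 -> g (- a) = 0 -> x ^+ 2 < a ^+ 2 ->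
  `|g x| <= 2 * M * (a ^+ 2 - x ^+ 2).
Proof.
move=> hg hM a2 ga gNa xa.
have cg : continuous g.
  move=> t; apply: differentiable_continuous; apply/derivable1_diffP.
  by have [] := hg t.
have M0 : 0 <= M by apply: le_trans (hM a _) => //.
have [x0|x0] := leP 0 x.
- have xa' : x < a by nra.
  have [c /[!in_itv]/= /andP[c1 c2] e] := MVT xa' (fun t _ => hg t) (continuous_subspaceT cg).
  have -> : g x = - (dg c * (a - x)) by rewrite -e ga; ring.
  have hc : `|dg c| <= M by apply: hM; nra.
  rewrite normrN normrM (ger0_norm (_ : 0 <= a - x)); last by lra.
  have : `|dg c| * (a - x) <= M * (a - x) by rewrite ler_wpM2r//; lra.
  have : 0 <= M * (a - x) by rewrite mulr_ge0//; lra.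
  have -> : 2 * M * (a ^+ 2 - x ^+ 2) = M * (a - x) * (2 * (a + x)) by ring.
  have : 1 <= 2 * (a + x) by lra.
  by move: (M * (a - x)) => u; nra.
- have xa' : - a < x by nra.
  have [c /[!in_itv]/= /andP[c1 c2] e] := MVT xa' (fun t _ => hg t) (continuous_subspaceT cg).
  have -> : g x = dg c * (x - - a) by rewrite -e gNa; ring.
  have hc : `|dg c| <= M by apply: hM; nra.
  rewrite normrM (ger0_norm (_ : 0 <= x - - a)); last by lra.
  have : `|dg c| * (x - - a) <= M * (x - - a) by rewrite ler_wpM2r//; lra.
  have : 0 <= M * (x - - a) by rewrite mulr_ge0//; lra.
  have -> : 2 * M * (a ^+ 2 - x ^+ 2) = M * (x - - a) * (2 * (a - x)) by ring.
  have : 1 <= 2 * (a - x) by lra.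
  by move: (M * (x - - a)) => u; nra.
Qed.

Lemma grad_bounded f : smooth_on setT f -> exists2 M : R, 0 < M &
  forall p, sqn p <= 1 -> `|f p| <= M /\ forall i, `|pd i f p| <= M.
Proof.
move=> sf.
have [M0 h0 H0] := continuous_bounded_disk (smooth_cont sf).
have [M1 h1 H1] := continuous_bounded_disk (smooth_cont (smooth_pd 0 sf)).
have [M2 h2 H2] := continuous_bounded_disk (smooth_cont (smooth_pd 1 sf)).
have l0 : M0 <= M0 + M1 + M2 by lra.
have l1 : M1 <= M0 + M1 + M2 by lra.
have l2 : M2 <= M0 + M1 + M2 by lra.
exists (M0 + M1 + M2); first by lra.
move=> p hp; split; first exact: le_trans (H0 p hp) l0.
move=> i; case: (ord2P i) => ->; first exact: le_trans (H1 p hp) l1.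
exact: le_trans (H2 p hp) l2.
Qed.

(** A point is joined to the circle along the axis of its larger coordinate.
    The half chord in that direction is at least [sqrt (1 / 2)], so that the distance to
    the circle is of order [1 - sqn p]; along a short chord it would only be of order
    [sqrt (1 - sqn p)], which does not suffice to control the gradient of a cutoff. *)
Lemma dist_bound f M : smooth_on setT f ->
  (forall p, sqn p <= 1 -> forall i, `|pd i f p| <= M) ->
  (forall p, sqn p = 1 -> f p = 0) ->
  forall p, sqn p < 1 -> `|f p| <= 2 * M * (1 - sqn p).
Proof.
move=> sf hM f0 [x y]; rewrite /sqn /= => hp.
have x0 := sqr_ge0 x; have y0 := sqr_ge0 y.
have [xy|xy] := leP (y ^+ 2) (x ^+ 2).
- pose a := Num.sqrt (1 - y ^+ 2).
  have ha : a ^+ 2 = 1 - y ^+ 2 by rewrite sqr_sqrtr; lra.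
  have a0 : 0 <= a by exact: sqrtr_ge0.
  have -> : 1 - (x ^+ 2 + y ^+ 2) = a ^+ 2 - x ^+ 2 by rewrite ha; ring.
  apply: (@chord_bound (fun t => f (t, y)) (fun t => pd 0 f (t, y))).
  + by move=> t; exact: is_derive_axis1.
  + by move=> t ht; apply: hM; rewrite /sqn /=; lra.
  + by nra.
  + by apply: f0; rewrite /sqn /=; lra.
  + by apply: f0; rewrite /sqn /= sqrrN; lra.
  + lra.
- pose a := Num.sqrt (1 - x ^+ 2).
  have ha : a ^+ 2 = 1 - x ^+ 2 by rewrite sqr_sqrtr; lra.
  have a0 : 0 <= a by exact: sqrtr_ge0.
  have -> : 1 - (x ^+ 2 + y ^+ 2) = a ^+ 2 - y ^+ 2 by rewrite ha; ring.
  apply: (@chord_bound (fun t => f (x, t)) (fun t => pd 1 f (x, t))).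
  + by move=> t; exact: is_derive_axis2.
  + by move=> t ht; apply: hM; rewrite /sqn /=; lra.
  + by nra.
  + by apply: f0; rewrite /sqn /=; lra.
  + by apply: f0; rewrite /sqn /= sqrrN; lra.
  + lra.
Qed.

(** Positive exactly where [1 - sqn p > 1 / n.+1], and going to infinity at each
    point of the disk. *)
Definition level (n : nat) p : R := n.+1%:R * (1 - sqn p) - 1.

Lemma smooth_level n : smooth_on setT (level n).
Proof.
apply: smooth_sub; last exact: smooth_cst.
apply: smooth_mul; first exact: smooth_cst.
by apply: smooth_sub; [exact: smooth_cst|exact: smooth_sqn].
Qed.

Lemma norm_pd_level n i p : `|pd i (level n) p| <= n.+1%:R * (2 * (`|p.1| + `|p.2|)).
Proof.
have sq : smooth_on setT (fun p : R * R => 1 - sqn p).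
  by apply: smooth_sub; [exact: smooth_cst|exact: smooth_sqn].
rewrite (pdB i (smooth_mul (smooth_cst (n.+1%:R : R)) sq) (smooth_cst 1)).
rewrite (pdZ n.+1%:R i sq) (pdB i (smooth_cst 1) (@smooth_sqn R)) !pd_cst.
rewrite (pdD i (smooth_sqr (@smooth_fst R)) (smooth_sqr (@smooth_snd R))).
rewrite (pdM i (@smooth_fst R) (@smooth_fst R)) (pdM i (@smooth_snd R) (@smooth_snd R)).
rewrite pd_fst pd_snd subr0 sub0r normrM ger0_norm// ler_wpM2l//.
by case: (ord2P i) => -> /=; rewrite ?mul0r ?mulr0 ?addr0 ?add0r !mul1r mulr1 normrN -mulr2n
  normrMn -mulr_natl; have := normr_ge0 p.1; have := normr_ge0 p.2; lra.
Qed.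

Definition cutoff n f p : R := f p * flat 0 (level n p).

Lemma smooth_cutoff n f : smooth_on setT f -> smooth_on setT (cutoff n f).
Proof. by move=> sf; apply: (smooth_mul sf); apply: smooth_flat; exact: smooth_level. Qed.

(** The support lies in the closed disk where [sqn p <= 1 - 1 / n.+1]. *)
Lemma test_cutoff n f : smooth_on setT f -> test_fun B (cutoff n f).
Proof.
move=> sf; pose K := [set p | sqn p <= 1 - n.+1%:R^-1 :> R].
have n0 : (0 : R) < n.+1%:R by rewrite ltr0n.
have cK : closed K by exact: closed_sublevel (smooth_cont (@smooth_sqn R)).
have h : closure [set p | cutoff n f p != 0] `<=` K.
  rewrite [X in _ `<=` X](_ : K = closure K); last by rewrite -closure_id.
  apply: closure_subset => p /=; rewrite /cutoff mulf_eq0 negb_or => /andP[_ hk].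
  have : 0 < level n p by rewrite ltNge; apply: contra hk => /flat_npos ->.
  rewrite /level subr_gt0 -ltr_pdivrMl// mulr1 /K /= => hn.
  by rewrite lerBrDr addrC -lerBrDr ltW.
have KB : K `<=` B.
  move=> p; rewrite diskE /K /= => hp.
  by apply: le_lt_trans hp _; rewrite ltrBlDr ltrDl invr_gt0.
split; first exact: smooth_cutoff.
  apply: (subclosed_compact _ (@cdisk_compact R)); first exact: closed_closure.
  by move=> p /h /KB; rewrite diskE /= => /ltW.
by move=> p /h /KB.
Qed.

(** Controls at once what the cutoff removes from a function and from its
    gradient, see [cutoff_error]. *)
Definition loss (t : R) := (1 - flat 0 t) + (flat 1 t + flat 2 t).

Lemma loss_ge0 t : 0 <= loss t.
Proof.
have := flat_le_fact 0 t; have := flat_ge0 1 t; have := flat_ge0 2 t.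
by rewrite /loss fact0; lra.
Qed.

Lemma loss_le4 t : loss t <= 4.
Proof.
have := flat_le_fact 1 t; have := flat_le_fact 2 t; have := flat_ge0 0 t.
by rewrite /loss !factS fact0 !muln1; lra.
Qed.

Lemma loss_le t : 1 <= t -> loss t <= 3 * t^-1.
Proof.
move=> t1; have t0 : 0 < t by lra.
have := flat_le_invX 1 t0; have := flat_le_invX 2 t0.
have : 1 - t^-1 <= flat 0 t by rewrite flat_pos// expr0 mul1r expR_ge1Dx.
have : t^-1 <= 1 by rewrite invf_le1.
have : 0 < t^-1 by rewrite invr_gt0.
rewrite /loss expr1; move: t^-1 => u; nra.
Qed.

(** The dangerous term of the gradient of the cutoff is
    [f * flat 2 (level n) * pd i (level n)].  The last factor is of order [n.+1], the
    first one of order [1 - sqn p], and [n.+1 * (1 - sqn p)] is [level n p + 1], so that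
    the product is bounded by [flat 1 + flat 2]. *)
Lemma cutoff_error n f C p :
  smooth_on setT f -> sqn p < 1 -> 0 <= C ->
  (`|f p| <= C /\ forall i, `|pd i f p| <= C) -> `|f p| <= C * (1 - sqn p) ->
  `|f p - cutoff n f p| <= 4 * C * loss (level n p) /\
  (forall i, `|pd i f p - pd i (cutoff n f) p| <= 4 * C * loss (level n p)).
Proof.
move=> sf hp C0 [f1 df1] f2.
have k1 : 0 <= 1 - flat 0 (level n p) by rewrite subr_ge0; exact: flat_le_fact.
have g1 := flat_ge0 1 (level n p); have g2 := flat_ge0 2 (level n p).
split.
  have -> : f p - cutoff n f p = f p * (1 - flat 0 (level n p)) by rewrite /cutoff; ring.
  rewrite normrM [X in _ * X]ger0_norm//.
  apply: (@le_trans _ _ (C * (1 - flat 0 (level n p)))); first by rewrite ler_wpM2r.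
  rewrite /loss; nra.
move=> i; rewrite (pdM i sf (smooth_flat 0 (smooth_level n))) (pd_flat0 i (smooth_level n)).
set k0 := flat 0 _ in k1 *; set k2 := flat 2 _ in g2 *; set D := pd i (level n) p.
have -> : pd i f p - (pd i f p * k0 + f p * (k2 * D)) =
  pd i f p * (1 - k0) - f p * D * k2 by ring.
have D1 : `|D| <= n.+1%:R * 4.
  apply: le_trans (norm_pd_level n i p) _; rewrite ler_wpM2l//.
  have [|] := @sqn_bound R 1 p ler01; first by rewrite expr1n ltW.
  by rewrite -!ler_norml => h1 h2; clear -h1 h2; lra.
have fD : `|f p * D * k2| <= 4 * C * (flat 1 (level n p) + k2).
  rewrite -(mul_flatS 1) -/k2 normrM [X in _ * X]ger0_norm//.
  have -> : level n p * k2 + k2 = (n.+1%:R * (1 - sqn p)) * k2 by rewrite /level; ring.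
  rewrite mulrA ler_wpM2r// normrM.
  apply: (@le_trans _ _ (C * (1 - sqn p) * (n.+1%:R * 4))).
    by apply: ler_pM.
  by have -> : C * (1 - sqn p) * (n.+1%:R * 4) = 4 * C * (n.+1%:R * (1 - sqn p)) by ring.
apply: le_trans (ler_normB _ _) _.
have : `|pd i f p * (1 - k0)| <= C * (1 - k0).
  by rewrite normrM [X in _ * X]ger0_norm// ler_wpM2r.
rewrite /loss -/k0 -/k2; nra.
Qed.

End Approx.

(** * Limits of test functions *)

Section Strong.
Variable R : realType.
Implicit Types (f g : R * R -> R) (p v : R * R) (i j : 'I_2).
Local Notation B := (disk ((0:R), (0:R)) 1).
Local Notation mu := (@leb2 R).

Definition W12_dist f (g : 'I_2 -> R * R -> R) phi p : R :=
  (f p - phi p) ^+ 2 + \sum_(i < 2) (g i p - pd i phi p) ^+ 2.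

(** The functions [f] that have [g] as gradient in the sense of limits of test
    functions.  Unlike the weak gradient, [g] is not tied to [f] by integration by
    parts here. *)
Definition W12_closure f (g : 'I_2 -> R * R -> R) :=
  [/\ L2 B f, forall i, L2 B (g i) &
    forall e : R, 0 < e -> exists2 phi, test_fun B phi & Int (W12_dist f g phi) < e].

Lemma L2_test f : test_fun B f -> L2 B f.
Proof. by move=> tf; apply: L2_smooth; exact: test_smooth tf. Qed.

Lemma intg_W12_dist f (g : 'I_2 -> R * R -> R) phi : L2 B f -> (forall i, L2 B (g i)) -> test_fun B phi ->
  disk_integrable (W12_dist f g phi).
Proof.
move=> Lf Lg tp; rewrite /W12_dist.
have -> : (fun p => (f p - phi p) ^+ 2 + \sum_(i < 2) (g i p - pd i phi p) ^+ 2) =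
  (fun p => (f p - phi p) ^+ 2 + ((g 0 p - pd 0 phi p) ^+ 2 + (g 1 p - pd 1 phi p) ^+ 2)).
  by apply/funext => p; rewrite sum_ord2.
apply: intgD; first by apply: L2_sqr; apply: L2B => //; exact: L2_test.
by apply: intgD; apply: L2_sqr; apply: L2B => //; apply: L2_test; exact: test_pd.
Qed.

Lemma W12_0_closure f : W12_0 B f -> exists2 g : 'I_2 -> R * R -> R, W12_grad B f g & W12_closure f g.
Proof.
move=> [g [Lf Hg] h]; exists g => //.
have Lg i : L2 B (g i) by exact: (Hg i).1.
split=> // e /h [phi tp hp]; exists phi => //.
have ie := intg_W12_dist Lf Lg tp.
by move: hp; rewrite (EFin_Int ie) lte_fin.
Qed.

Lemma loss_cvg0 p : sqn p < 1 -> loss (level n p) @[n --> \oo] --> (0 : R).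
Proof.
move=> hp; have s0 : 0 < 1 - sqn p by lra.
set s := 1 - sqn p in s0.
pose K := 6 * s^-1.
have K0 : 0 < K by rewrite mulr_gt0// invr_gt0.
(* Once [level n p] is at least [1], that is at least [n.+1 * s / 2], [loss_le] applies. *)
apply: (@squeeze_cvgr _ _ _ _ (fun=> 0) (fun n => K * harmonic n)); last 2 first.
- exact: cvg_cst.
- by rewrite -[X in _ --> X](mulr0 K); apply: cvgM; [exact: cvg_cst|exact: cvg_harmonic].
have : \forall n \near \oo, harmonic n < s / 2 :> R.
  by apply: (cvgr_lt _ (@cvg_harmonic R)); rewrite divr_gt0.
apply: filterS => n; rewrite /harmonic /= => hn.
rewrite loss_ge0 /=.
have n0 : (0 : R) < n.+1%:R by rewrite ltr0n.
have n1 : 1 <= n.+1%:R :> R by rewrite ler1n.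
have h1 : 1 < n.+1%:R * (s / 2) by rewrite -ltr_pdivrMl// mulr1.
have lE : level n p = n.+1%:R * s - 1 by [].
have l1 : n.+1%:R * (s / 2) <= level n p by rewrite lE; lra.
apply: le_trans (loss_le _) _; first by lra.
have : (level n p)^-1 <= (n.+1%:R * (s / 2))^-1.
  by rewrite lef_pV2 ?posrE//; lra.
have -> : K / n.+1%:R = 3 * (n.+1%:R * (s / 2))^-1.
  by rewrite /K !invfM invrK; ring.
by move=> h; rewrite ler_wpM2l.
Qed.

(** The cutoffs converge by dominated convergence: the error is bounded
    by a multiple of [loss (level n)], which is bounded and tends to zero pointwise. *)
Lemma smooth_W12_closure f : smooth_on setT f -> (forall p, sqn p = 1 -> f p = 0) ->
  W12_closure f (fun i => pd i f).
Proof.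
move=> sf f0; have L1 := L2_smooth sf.
have L2 i : L2 B (pd i f) by apply: L2_smooth; exact: smooth_pd.
split=> // e e0.
have [M M0 hM] := grad_bounded sf.
have hd := dist_bound sf (fun p hp => (hM p hp).2) f0.
pose C := 2 * M; have C0 : 0 <= C by rewrite /C; lra.
pose F n := W12_dist f (fun i => pd i f) (cutoff n f).
have Fge n p : 0 <= F n p.
  by rewrite /F /W12_dist sum_ord2 !addr_ge0 ?sqr_ge0.
have Fle n p : B p -> F n p <= 48 * C ^+ 2 * loss (level n p) ^+ 2.
  rewrite diskE => hp; have [h1 h2] := hM p (ltW hp).
  have h1' : `|f p| <= C by rewrite /C; lra.
  have h2' i : `|pd i f p| <= C by rewrite /C; have := h2 i; lra.
  have [e1 e2] := cutoff_error n sf hp C0 (conj h1' h2') (hd p hp).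
  rewrite /F /W12_dist sum_ord2.
  have sq (x y : R) : `|x| <= y -> x ^+ 2 <= y ^+ 2.
    by move=> xy; rewrite -(real_normK (num_real x)) ler_sqr ?nnegrE// (le_trans _ xy).
  (* One square of [4 * C * loss] for the function and one for each derivative. *)
  have -> : 48 * C ^+ 2 * loss (level n p) ^+ 2 = (4 * C * loss (level n p)) ^+ 2 +
     ((4 * C * loss (level n p)) ^+ 2 + (4 * C * loss (level n p)) ^+ 2) by ring.
  by rewrite !lerD// sq.
have iF n : disk_integrable (F n) by exact: intg_W12_dist L1 L2 (test_cutoff n sf).
have [] := @dominated_convergence _ _ _ mu B (@measurable_disk R) (fun n p => (F n p)%:E) (fun=> 0%E)
   (fun=> (48 * C ^+ 2 * 4 ^+ 2)%:E).
- by move=> n; apply: measurable_int (iF n).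
- exact: measurable_cst.
- apply: aeW => p Bp; apply: cvg_EFin.
    by near=> n.
  have Bp' : sqn p < 1 by move: Bp; rewrite diskE.
  apply: (@squeeze_cvgr _ _ _ _ (fun=> 0) (fun n => 48 * C ^+ 2 * loss (level n p) ^+ 2)).
  + by near=> n; rewrite Fge Fle.
  + exact: cvg_cst.
  + rewrite -[X in _ --> X](mulr0 (48 * C ^+ 2)); apply: cvgM; first exact: cvg_cst.
    rewrite -[X in _ --> X](mulr0 0); apply: cvgM; exact: loss_cvg0.
- by apply: intg_cont; exact: cst_continuous.
- apply: aeW => p n Bp; rewrite gee0_abs ?lee_fin//.
  apply: le_trans (Fle n p Bp) _; rewrite ler_wpM2l//; first by rewrite mulr_ge0 ?sqr_ge0.
  by rewrite ler_sqr ?nnegrE// ?loss_ge0// loss_le4.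
move=> _ _; rewrite integral0 => hc.
have hI : Int (F n) @[n --> \oo] --> 0 by exact: fine_cvg hc.
have [n _ /(_ n (leqnn n)) hn] := cvgr_lt 0 hI e e0.
by exists (cutoff n f); [exact: test_cutoff|exact: hn].
Unshelve. all: by end_near. Qed.

End Strong.

(** * The energy estimate *)

Section Uniq.
Variable R : realType.
Implicit Types (f : R * R -> R) (p v : R * R) (i j : 'I_2).
Local Notation B := (disk ((0:R), (0:R)) 1).
Local Notation mu := (@leb2 R).

Lemma W12_gradD f f' (g g' : 'I_2 -> R * R -> R) : W12_grad B f g -> W12_grad B f' g' ->
  W12_grad B (fun p => f p + f' p) (fun i p => g i p + g' i p).
Proof.
move=> [Lf hg] [Lf' hg']; split; first exact: L2D.
move=> i; have [Lg wg] := hg i; have [Lg' wg'] := hg' i; split; first exact: L2D.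
move=> phi tp; have Lp := L2_test tp; have Ldp := L2_test (test_pd i tp).
rewrite -!/(Int _).
rewrite (_ : (fun p => (f p + f' p) * pd i phi p) =
             (fun p => f p * pd i phi p + f' p * pd i phi p)); last first.
  by apply/funext => p; ring.
rewrite (_ : (fun p => (g i p + g' i p) * phi p) =
             (fun p => g i p * phi p + g' i p * phi p)); last first.
  by apply/funext => p; ring.
rewrite !IntD; try exact: L2_mul.
have := wg _ tp; have := wg' _ tp; rewrite -!/(Int _) => -> ->; ring.
Qed.

Lemma W12_gradN f (g : 'I_2 -> R * R -> R) : W12_grad B f g ->
  W12_grad B (fun p => (-1) * f p) (fun i p => (-1) * g i p).
Proof.
move=> [Lf hg]; split; first exact: L2Z.
move=> i; have [Lg wg] := hg i; split; first exact: L2Z.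
move=> phi tp; have Lp := L2_test tp; have Ldp := L2_test (test_pd i tp).
rewrite -!/(Int _).
rewrite (_ : (fun p => (-1) * f p * pd i phi p) =
             (fun p => (-1) * (f p * pd i phi p))); last first.
  by apply/funext => p; ring.
rewrite (_ : (fun p => (-1) * g i p * phi p) =
             (fun p => (-1) * (g i p * phi p))); last first.
  by apply/funext => p; ring.
rewrite !IntZ; try exact: L2_mul.
have := wg _ tp; rewrite -!/(Int _) => ->; ring.
Qed.

(** Two weak gradients of the same function agree against test functions.
    This replaces their equality almost everywhere. *)
Lemma W12_grad_same f (g g' : 'I_2 -> R * R -> R) i phi : W12_grad B f g -> W12_grad B f g' ->
  test_fun B phi -> Int (fun p => g i p * phi p) = Int (fun p => g' i p * phi p).
Proof.
move=> [_ hg] [_ hg'] tp; apply: oppr_inj.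
by have [_ /(_ _ tp)] := hg i; have [_ /(_ _ tp)] := hg' i; rewrite -!/(Int _) => <- <-.
Qed.

(* The axes, in either order; the proofs below see them through these three facts. *)
Variables a b : 'I_2.
Hypotheses (ab : b != a) (Iab : forall i, i = a \/ i = b)
  (sumab : forall F : 'I_2 -> R, \sum_(i < 2) F i = F a + F b).

Lemma sqr_subD (x y z t : R) :
  (x + y - (z + t)) ^+ 2 <= 2 * (x - z) ^+ 2 + 2 * (y - t) ^+ 2.
Proof.
rewrite -subr_ge0 (_ : _ - _ = ((x - z) - (y - t)) ^+ 2) ?sqr_ge0//; ring.
Qed.

Lemma W12_closureD f f' (g g' : 'I_2 -> R * R -> R) : W12_closure f g -> W12_closure f' g' ->
  W12_closure (fun p => f p + f' p) (fun i p => g i p + g' i p).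
Proof.
move=> [Lf Lg h] [Lf' Lg' h']; split; [exact: L2D|by move=> i; exact: L2D|].
move=> e e0; have e4 : 0 < e / 4 by lra.
have [phi tp hp] := h _ e4; have [phi' tp' hp'] := h' _ e4.
have i1 := intg_W12_dist Lf Lg tp; have i2 := intg_W12_dist Lf' Lg' tp'.
exists (fun p => phi p + phi' p); first exact: test_add.
apply: (@le_lt_trans _ _ (Int (fun p => 2 * W12_dist f g phi p + 2 * W12_dist f' g' phi' p))).
  apply: le_Int.
  - by apply: intg_W12_dist; [exact: L2D|move=> i; exact: L2D|exact: test_add].
  - by apply: intgD; exact: intgZ.
  move=> p _; rewrite /W12_dist !sumab.
  rewrite !(pdD _ (test_smooth tp) (test_smooth tp')).
  apply: (@le_trans _ _ ((2 * (f p - phi p) ^+ 2 + 2 * (f' p - phi' p) ^+ 2) +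
    ((2 * (g a p - pd a phi p) ^+ 2 + 2 * (g' a p - pd a phi' p) ^+ 2) +
    (2 * (g b p - pd b phi p) ^+ 2 + 2 * (g' b p - pd b phi' p) ^+ 2)))).
    by apply: lerD; [|apply: lerD]; exact: sqr_subD.
  rewrite le_eqVlt; apply/orP; left; apply/eqP.
  by move: (pd a phi p) (pd a phi' p) (pd b phi p) (pd b phi' p) => *; ring.
rewrite (IntD (intgZ 2 i1) (intgZ 2 i2)) (IntZ 2 i1) (IntZ 2 i2).
by move: hp hp'; move: (Int _) (Int _) => x y; lra.
Qed.

Lemma W12_closureN f (g : 'I_2 -> R * R -> R) : W12_closure f g ->
  W12_closure (fun p => (-1) * f p) (fun i p => (-1) * g i p).
Proof.
move=> [Lf Lg h]; split; [exact: L2Z|by move=> i; exact: L2Z|].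
move=> e e0; have [phi tp hp] := h _ e0.
exists (fun p => (-1) * phi p); first by apply: (test_mulr (smooth_cst _) tp).
apply: le_lt_trans hp; rewrite le_eqVlt; apply/orP; left; apply/eqP.
apply: eq_Int => p _; rewrite /W12_dist !sumab !(pdZ _ _ (test_smooth tp)).
by move: (pd a phi p) (pd b phi p) => *; ring.
Qed.

Variables (m l : R).
Hypotheses (m0 : 0 < m) (ml0 : 0 < m + l).

Implicit Type (D G N : 'I_2 -> 'I_2 -> R * R -> R) (P : 'I_2 -> R * R -> R).

(** The integrand of the weak form of equation [i], with [D i j] for the
    derivative of the component [i] in the direction [j], and [P] for the gradient of
    the test function. *)
Definition lame_integrand D i P p : R :=
  m * (\sum_(j < 2) (D i j p + D j i p) * P j p) + l * (\sum_(j < 2) D j j p) * P i p.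

(** The shape shared by every sum of six terms into which
    [lame_integrand] expands. *)
Lemma Int_combination f1 f2 f3 f4 f5 f6 :
  disk_integrable f1 -> disk_integrable f2 -> disk_integrable f3 -> disk_integrable f4 -> disk_integrable f5 -> disk_integrable f6 ->
  let F p := m * (f1 p + f2 p + (f3 p + f4 p)) + l * (f5 p + f6 p) in
  disk_integrable F /\ Int F = m * (Int f1 + Int f2 + (Int f3 + Int f4)) + l * (Int f5 + Int f6).
Proof.
move=> h1 h2 h3 h4 h5 h6 F.
have H1 := intgD h1 h2; have H2 := intgD h3 h4; have H3 := intgD h5 h6.
have H4 := intgD H1 H2; have H5 := intgZ m H4; have H6 := intgZ l H3.
split; first exact: intgD.
by rewrite (IntD H5 H6) (IntZ m H4) (IntZ l H3) (IntD H1 H2) (IntD h1 h2) (IntD h3 h4) (IntD h5 h6).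
Qed.

Lemma combination_congr (x1 x2 x3 x4 x5 x6 y1 y2 y3 y4 y5 y6 : R) :
  x1 = y1 -> x2 = y2 -> x3 = y3 -> x4 = y4 -> x5 = y5 -> x6 = y6 ->
  m * (x1 + x2 + (x3 + x4)) + l * (x5 + x6) = m * (y1 + y2 + (y3 + y4)) + l * (y5 + y6).
Proof. by move=> -> -> -> -> -> ->. Qed.

Lemma combination_opp (x1 x2 x3 x4 x5 x6 : R) :
  0 = m * (x1 + x2 + (x3 + x4)) + l * (x5 + x6) ->
  m * (- x1 + - x2 + (- x3 + - x4)) + l * (- x5 + - x6) = 0.
Proof. by move=> e; rewrite -[RHS]oppr0 e; ring. Qed.

Lemma lame_integrandE D i P : lame_integrand D i P = fun p =>
  m * (D i a p * P a p + D a i p * P a p + (D i b p * P b p + D b i p * P b p)) +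
  l * (D a a p * P i p + D b b p * P i p).
Proof. by apply/funext => p; rewrite /lame_integrand !sumab; ring. Qed.

Lemma Int_lame_integrand D i P : (forall i j, L2 B (D i j)) -> (forall j, L2 B (P j)) ->
  disk_integrable (lame_integrand D i P) /\
  Int (lame_integrand D i P) =
    m * (Int (fun p => D i a p * P a p) + Int (fun p => D a i p * P a p) +
      (Int (fun p => D i b p * P b p) + Int (fun p => D b i p * P b p))) +
    l * (Int (fun p => D a a p * P i p) + Int (fun p => D b b p * P i p)).
Proof. by move=> LD LP; rewrite lame_integrandE; apply: Int_combination; exact: L2_mul. Qed.

Lemma lame_integrandB D G i P p :
  lame_integrand (fun i j p => D i j p + (-1) * G i j p) i P p = lame_integrand D i P p - lame_integrand G i P p.
Proof. by rewrite /lame_integrand !sumab; ring. Qed.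

Lemma W12_grad_L2 f (g : 'I_2 -> R * R -> R) j : W12_grad B f g -> L2 B (g j).
Proof. by move=> [_ /(_ j) []]. Qed.

(** The integrand only sees the gradient through its products with
    derivatives of test functions, which are test functions. *)
Lemma lame_integrand_same (w : 'I_2 -> R * R -> R) D G i phi :
  (forall i, W12_grad B (w i) (D i)) -> (forall i, W12_grad B (w i) (G i)) ->
  test_fun B phi ->
  Int (lame_integrand D i (fun j => pd j phi)) = Int (lame_integrand G i (fun j => pd j phi)).
Proof.
move=> hD hG tp; have tdp j := test_pd j tp.
have LP j : L2 B (pd j phi) by exact: L2_test.
have E i' j' j : Int (fun p => D i' j' p * pd j phi p) = Int (fun p => G i' j' p * pd j phi p).
  exact: W12_grad_same (hD i') (hG i') (tdp j).
have [_ ->] := Int_lame_integrand i (fun i j => W12_grad_L2 j (hD i)) LP.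
have [_ ->] := Int_lame_integrand i (fun i j => W12_grad_L2 j (hG i)) LP.
exact: combination_congr.
Qed.

Lemma lame_integrand_diff D G i phi : (forall i j, L2 B (D i j)) -> (forall i j, L2 B (G i j)) ->
  test_fun B phi ->
  Int (lame_integrand D i (fun j => pd j phi)) = 0 -> Int (lame_integrand G i (fun j => pd j phi)) = 0 ->
  Int (lame_integrand (fun i j p => D i j p + (-1) * G i j p) i (fun j => pd j phi)) = 0.
Proof.
move=> LD LG tp D0 G0.
have LP j : L2 B (pd j phi) by apply: L2_test; exact: test_pd.
have [iD _] := Int_lame_integrand i LD LP; have [iG _] := Int_lame_integrand i LG LP.
rewrite (eq_Int (fun p _ => lame_integrandB D G i _ p)).
by rewrite (IntB iD iG) D0 G0 subrr.
Qed.

(** Integrating by parts turns the weak form into the integral of the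
    equation times the test function. *)
Lemma smooth_lame_integrand (U : 'I_2 -> R * R -> R) i phi :
  (forall i, smooth_on setT (U i)) -> test_fun B phi ->
  (forall p, m * (\sum_(j < 2) (pd j (pd j (U i)) p + pd j (pd i (U j)) p)) +
    l * (\sum_(j < 2) pd i (pd j (U j)) p) = 0) ->
  Int (lame_integrand (fun i j => pd j (U i)) i (fun j => pd j phi)) = 0.
Proof.
move=> sU tp pde.
have sD i' j' : smooth_on setT (pd j' (U i')) := smooth_pd j' (sU i').
have LD i' j' : L2 B (pd j' (U i')) := L2_smooth (sD i' j').
have LP j : L2 B (pd j phi) by apply: L2_test; exact: test_pd.
have Lp : L2 B phi := L2_test tp.
have LE i' j' j : L2 B (pd j (pd j' (U i'))) by apply: L2_smooth; exact: smooth_pd.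
have [_ ->] := Int_lame_integrand i LD LP.
have H i' j' j : disk_integrable (fun p => pd j (pd j' (U i')) p * phi p) := L2_mul (LE i' j' j) Lp.
have E i' j' j := Int_by_parts j (sD i' j') tp.
rewrite (combination_congr (E i a a) (E a i a) (E i b b) (E b i b) (E a a i) (E b b i)).
have [_] := Int_combination (H i a a) (H a i a) (H i b b) (H b i b) (H a a i) (H b b i).
have -> : Int (fun p => m * (pd a (pd a (U i)) p * phi p + pd a (pd i (U a)) p * phi p +
    (pd b (pd b (U i)) p * phi p + pd b (pd i (U b)) p * phi p)) +
    l * (pd i (pd a (U a)) p * phi p + pd i (pd b (U b)) p * phi p)) = 0.
  have -> : 0 = Int (fun=> 0 * 0 : R).
    rewrite (IntZ 0 (intg_cont (@cst_continuous _ _ 0))) mul0r //.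
  apply: eq_Int => p _; rewrite mul0r -[RHS](mul0r (phi p)) -(pde p) !sumab.
  by move: (pd a (pd a _) p) (pd a (pd i _) p) (pd b (pd b _) p) (pd b (pd i _) p)
    (pd i (pd a _) p) (pd i (pd b _) p) => *; ring.
exact: combination_opp.
Qed.

(** The symmetric bilinear form of the elastic energy: only the symmetric part of
    [M] and [N] enters. *)
Definition eform (M N : 'I_2 -> 'I_2 -> R) : R :=
  2 * m * (M a a * N a a + M b b * N b b) + m * ((M a b + M b a) * (N a b + N b a))
  + l * ((M a a + M b b) * (N a a + N b b)).

(** The form controls the deviatoric part of the diagonal by [m] and the trace by
    [m + l]. *)
Definition kappa := Num.min m (m + l).

Lemma kappa_gt0 : 0 < kappa. Proof. by rewrite /kappa lt_min m0. Qed.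

Lemma eform_coercive (N : 'I_2 -> 'I_2 -> R) : 2 * kappa * (N a a ^+ 2 + N b b ^+ 2) <= eform N N.
Proof.
rewrite /eform; have k1 : kappa <= m by rewrite /kappa ge_min lexx.
have k2 : kappa <= m + l by rewrite /kappa ge_min lexx orbT.
move: (N a a) (N b b) (N a b + N b a) => x y s.
have h1 : kappa * (x - y) ^+ 2 <= m * (x - y) ^+ 2 by rewrite ler_wpM2r ?sqr_ge0.
have h2 : kappa * (x + y) ^+ 2 <= (m + l) * (x + y) ^+ 2 by rewrite ler_wpM2r ?sqr_ge0.
have h3 : 0 <= m * s ^+ 2 by rewrite mulr_ge0 ?sqr_ge0// ltW.
move: kappa h1 h2 h3 => k *; nra.
Qed.

Definition sqnorm (M : 'I_2 -> 'I_2 -> R) : R :=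
  M a a ^+ 2 + M a b ^+ 2 + (M b a ^+ 2 + M b b ^+ 2).

Lemma eform_le (M : 'I_2 -> 'I_2 -> R) : eform M M <= (2 * m + 2 * `|l|) * sqnorm M.
Proof.
rewrite /eform /sqnorm; have l1 := ler_norm l; have l0 := normr_ge0 l.
move: (M a a) (M a b) (M b a) (M b b) => x y z t.
have h1 : l * (x + t) ^+ 2 <= `|l| * (x + t) ^+ 2 by rewrite ler_wpM2r ?sqr_ge0.
have h2 : 0 <= `|l| * (x - t) ^+ 2 by rewrite mulr_ge0 ?sqr_ge0.
have h3 : 0 <= m * (y - z) ^+ 2 by rewrite mulr_ge0 ?sqr_ge0// ltW.
have h4 : 0 <= `|l| * y ^+ 2 by rewrite mulr_ge0 ?sqr_ge0.
have h5 : 0 <= `|l| * z ^+ 2 by rewrite mulr_ge0 ?sqr_ge0.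
have h6 : 0 <= m * x ^+ 2 by rewrite mulr_ge0 ?sqr_ge0// ltW.
have h7 : 0 <= m * t ^+ 2 by rewrite mulr_ge0 ?sqr_ge0// ltW.
move: `|l| h1 h2 h3 h4 h5 h6 h7 => k *; nra.
Qed.

(** Since the form is nonnegative, expanding it at [G - N] gives
    [2 * eform G N >= eform N N - eform (G - N) (G - N)]. *)
Lemma eform_energy (G N : 'I_2 -> 'I_2 -> R) :
  kappa * (N a a ^+ 2 + N b b ^+ 2)
    - (m + `|l|) * sqnorm (fun i j => G i j - N i j) <= eform G N.
Proof.
have h1 := eform_coercive N.
have h2 := eform_le (fun i j => G i j - N i j).
have h3 : 0 <= eform G G.
  apply: le_trans (eform_coercive G); rewrite mulr_ge0 ?addr_ge0 ?sqr_ge0//.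
  by have := kappa_gt0; lra.
have e : eform (fun i j => G i j - N i j) (fun i j => G i j - N i j) =
   eform G G + eform N N - 2 * eform G N by rewrite /eform; ring.
move: h1 h2 h3 e.
move: (eform G G) (eform G N) (eform N N) (eform _ _) (sqnorm _) => q1 q2 q3 q4 n *.
lra.
Qed.

Lemma split_bound (x y u v : R) : 0 <= u -> 0 <= v ->
  x ^+ 2 <= 2 * ((x - y) ^+ 2 + (u + v)) + 2 * y ^+ 2.
Proof. by move=> u0 v0; have := sqr_ge0 (x - 2 * y); nra. Qed.

Lemma final_bound (x d y z t : R) : y < d -> z <= x * (2 * d) -> t <= 4 * z ->
  2 * y + 2 * t <= (2 + 16 * x) * d.
Proof. lra. Qed.

(** With [N] the gradient of test functions the hypotheses say that the weak
    form vanishes for [G], so [eform G N] has zero integral. *)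
Lemma Int_energy G N : (forall i j, L2 B (G i j)) -> (forall i j, L2 B (N i j)) ->
  Int (lame_integrand G a (N a)) = 0 -> Int (lame_integrand G b (N b)) = 0 ->
  kappa * (Int (fun p => N a a p ^+ 2) + Int (fun p => N b b p ^+ 2)) <=
  (m + `|l|) * Int (fun p => sqnorm (fun i j => G i j p - N i j p)).
Proof.
move=> LG LN Ea Eb.
have [Sa _] := Int_lame_integrand a LG (LN a); have [Sb _] := Int_lame_integrand b LG (LN b).
have QE : (fun p => lame_integrand G a (N a) p + lame_integrand G b (N b) p) =
    (fun p => eform (fun i j => G i j p) (fun i j => N i j p)).
  by apply/funext => p; rewrite /lame_integrand !sumab /eform; ring.
have iQ := intgD Sa Sb; rewrite QE in iQ.
have IQ := IntD Sa Sb; rewrite Ea Eb addr0 QE in IQ.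
have sN i j : disk_integrable (fun p => N i j p ^+ 2) := L2_sqr (LN i j).
have sG i j : disk_integrable (fun p => (G i j p - N i j p) ^+ 2) := L2_sqr (L2B (LG i j) (LN i j)).
have iN := intgD (sN a a) (sN b b).
have iE := intgD (intgD (sG a a) (sG a b)) (intgD (sG b a) (sG b b)).
have := le_Int (intgB (intgZ kappa iN) (intgZ (m + `|l|) iE)) iQ
  (fun p _ => eform_energy (fun i j => G i j p) (fun i j => N i j p)).
by rewrite IQ (IntB (intgZ kappa iN) (intgZ _ iE)) (IntZ kappa iN) (IntZ _ iE) subr_le0 (IntD (sN a a) (sN b b)).
Qed.

(** The diagonal entries of the gradient of nearby test functions are
    bounded by their distance to [w], and the Poincare inequality in the direction [i]
    then bounds the component [i]. *)
Lemma W12_closure_unique (w : 'I_2 -> R * R -> R) G :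
  (forall i, W12_closure (w i) (G i)) ->
  (forall i phi, test_fun B phi -> Int (lame_integrand G i (fun j => pd j phi)) = 0) ->
  forall i, Int (fun p => w i p ^+ 2) = 0.
Proof.
move=> hs hE i.
have Lw i' : L2 B (w i') by case: (hs i').
have LG i' j' : L2 B (G i' j') by case: (hs i') => _ + _; apply.
have k0 := kappa_gt0.
(* The bound obtained at the end for tests at distance [d] is [K * d]. *)
pose K := 2 + 16 * ((m + `|l|) / kappa).
have L0 : 0 <= m + `|l| by rewrite addr_ge0// ltW.
have K0 : 0 < K by rewrite /K ltr_wpDr// !mulr_ge0// invr_ge0 ltW.
have Iw0 : 0 <= Int (fun p => w i p ^+ 2) by apply: Int_ge0 => p _; exact: sqr_ge0.
apply/eqP; rewrite eq_le Iw0 andbT; apply/ler_addgt0Pr => e e0; rewrite add0r.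
have d0 : 0 < e / K by rewrite divr_gt0.
have [psi0 t0 h0] : exists2 psi, test_fun B psi & Int (W12_dist (w a) (G a) psi) < e / K.
  by have [_ _] := hs a; apply.
have [psi1 t1 h1] : exists2 psi, test_fun B psi & Int (W12_dist (w b) (G b) psi) < e / K.
  by have [_ _] := hs b; apply.
pose psi i' : R * R -> R := if i' == a then psi0 else psi1.
have tpsi i' : test_fun B (psi i') by rewrite /psi; case: ifP.
have hpsi i' : Int (W12_dist (w i') (G i') (psi i')) < e / K.
  by case: (Iab i') => ->; rewrite /psi ?eqxx ?(negPf ab); [exact: h0|exact: h1].
have ierr i' : disk_integrable (W12_dist (w i') (G i') (psi i')) := intg_W12_dist (Lw i') (LG i') (tpsi i').
(* Opaque, so that unification does not unfold the derivatives. *)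
have [N NE] : exists N : 'I_2 -> 'I_2 -> R * R -> R, N = fun i' j' => pd j' (psi i').
  by eexists.
have LN i' j' : L2 B (N i' j') by rewrite NE; apply: L2_test; exact: test_pd.
have Ea : Int (lame_integrand G a (N a)) = 0 by rewrite NE; exact: hE.
have Eb : Int (lame_integrand G b (N b)) = 0 by rewrite NE; exact: hE.
have hkap := Int_energy LG LN Ea Eb.
have errE i' : W12_dist (w i') (G i') (psi i') = fun p => (w i' p - psi i' p) ^+ 2 +
    ((G i' a p - N i' a p) ^+ 2 + (G i' b p - N i' b p) ^+ 2).
  by apply/funext => p; rewrite /W12_dist sumab NE.
have sG i' j' : disk_integrable (fun p => (G i' j' p - N i' j' p) ^+ 2).
  by apply: L2_sqr; exact: L2B.
have iE : disk_integrable (fun p => sqnorm (fun i j => G i j p - N i j p)).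
  by apply: intgD; exact: intgD.
have n0 : 0 <= Int (fun p => N a a p ^+ 2) by apply: Int_ge0 => p _; exact: sqr_ge0.
have n1 : 0 <= Int (fun p => N b b p ^+ 2) by apply: Int_ge0 => p _; exact: sqr_ge0.
have hE2 : Int (fun p => sqnorm (fun i j => G i j p - N i j p)) <= 2 * (e / K).
  apply: (@le_trans _ _ (Int (fun p => W12_dist (w a) (G a) (psi a) p + W12_dist (w b) (G b) (psi b) p))).
    apply: le_Int => //; first exact: intgD.
    by move=> p _; rewrite !errE /sqnorm lerD// lerDr sqr_ge0.
  rewrite (IntD (ierr a) (ierr b)).
  by rewrite [leRHS]mulr_natl mulr2n; apply: lerD; apply: ltW; exact: hpsi.
have hN : Int (fun p => N i i p ^+ 2) <= (m + `|l|) / kappa * (2 * (e / K)).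
  have -> : (m + `|l|) / kappa * (2 * (e / K)) = kappa^-1 * ((m + `|l|) * (2 * (e / K))).
    by rewrite mulrAC mulrC.
  rewrite ler_pdivlMl//.
  apply: le_trans (ler_wpM2l L0 hE2); apply: le_trans hkap.
  by rewrite ler_pM2l//; case: (Iab i) => ->; rewrite ?lerDl ?lerDr.
have hP : Int (fun p => psi i p ^+ 2) <= 4 * Int (fun p => N i i p ^+ 2).
  by rewrite NE; exact: Poincare_test.
have ipsi : disk_integrable (fun p => psi i p ^+ 2) := L2_sqr (L2_test (tpsi i)).
have : Int (fun p => w i p ^+ 2) <=
   Int (fun p => 2 * W12_dist (w i) (G i) (psi i) p + 2 * psi i p ^+ 2).
  apply: le_Int; [exact: L2_sqr|by apply: intgD; exact: intgZ|].
  move=> p _; rewrite errE.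
  exact: split_bound (sqr_ge0 _) (sqr_ge0 _).
move=> /le_trans; apply.
rewrite (IntD (intgZ 2 (ierr i)) (intgZ 2 ipsi)) (IntZ 2 (ierr i)) (IntZ 2 ipsi).
have -> : e = K * (e / K) by rewrite mulrCA mulfV ?mulr1// gt_eqF.
exact: final_bound (hpsi i) hN hP.
Qed.

End Uniq.

(** * Uniqueness and classical solutions *)

Section Lame.
Variable R : realType.
Implicit Types (p v : R * R) (i j : 'I_2).
Local Notation B := (disk ((0:R), (0:R)) 1).
Local Notation mu := (@leb2 R).

Lemma ord2_neq01 : (1 : 'I_2) != 0. Proof. by []. Qed.

Lemma closure_disk : closure B `<=` cdisk (R := R).
Proof.
rewrite [X in _ `<=` X](_ : _ = closure (cdisk (R := R))).
  by apply: closure_subset => p; rewrite diskE => /ltW.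
by rewrite -closure_id//; exact: closed_sublevel (smooth_cont (@smooth_sqn R)).
Qed.

(** A point [p] of the circle is the limit of the points [(1 - t) * p]. *)
Lemma boundary_disk p : boundary B p <-> sqn p = 1.
Proof.
have iB : interior B = B by apply: (proj1 (interior_id _)); exact: disk_open.
rewrite /boundary iB; split.
  move=> [/closure_disk h1 h2]; apply/eqP; rewrite eq_le h1 leNgt; apply/negP => h.
  by apply: h2; rewrite diskE.
move=> hp; split; last by rewrite diskE /= hp ltxx.
move=> V; rewrite -nbhs_ballE => -[e /= e0 he].
(* The bound [e / 4] keeps [(1 - t) * p] within [e] of [p], and [1 / 2] keeps [1 - t]
   in the unit interval. *)
pose t := Num.min (e / 4) (1 / 2).
have t0 : 0 < t by rewrite lt_min; apply/andP; split; lra.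
have t1 : t <= 1 / 2 by rewrite /t ge_min lexx orbT.
have te : t <= e / 4 by rewrite /t ge_min lexx.
have hp' : p.1 ^+ 2 + p.2 ^+ 2 = 1 := hp.
have [|] := @sqn_bound R 1 p ler01; first by rewrite hp expr1n.
rewrite -!ler_norml => a1 a2.
exists ((1 - t) * p.1, (1 - t) * p.2); split.
  rewrite diskE /sqn /= !exprMn -mulrDr hp' mulr1; nra.
have k (x : R) : `|x| <= 1 -> `|x - (1 - t) * x| < e.
  move=> x1; have -> : x - (1 - t) * x = t * x by ring.
  by rewrite normrM (ger0_norm (ltW t0)); nra.
by apply: he; split; rewrite /ball /=; exact: k.
Qed.

Lemma test_zero : test_fun B (fun=> 0).
Proof.
split; first exact: smooth_cst.
  rewrite (_ : [set p | _] = set0) ?closure0; first exact: compact0.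
  by apply/seteqP; split => // p /=; rewrite eqxx.
rewrite (_ : [set p | _] = set0) ?closure0//.
by apply/seteqP; split => // p /=; rewrite eqxx.
Qed.

Lemma W12_0_zero : W12_0 B (fun=> 0 : R).
Proof.
exists (fun i => pd i (fun=> 0 : R)); first exact: W12_grad_smooth (smooth_cst 0).
move=> e e0; exists (fun=> 0); first exact: test_zero.
rewrite (_ : (fun p => _) = cst 0%E); first by rewrite integral0 lte_fin.
by apply/funext => p; rewrite sum_ord2 !subrr expr0n /= !addr0.
Qed.

Variables (m l : R).
Hypotheses (m0 : 0 < m) (ml0 : 0 < m + l).

(** The two extensions of the boundary data may differ; their difference
    vanishes on the circle and is therefore a limit of test functions too. *)
Lemma lame_unique (Phi u v : R * R -> R * R) :
  lame_solution m l B Phi u -> lame_solution m l B Phi v ->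
  {ae mu, forall p, B p -> v p = u p}.
Proof.
move=> [[Psi [sPsi bPsi zPsi]] [Du [wDu eDu]]] [[Psi' [sPsi' bPsi' zPsi']] [Dv [wDv eDv]]].
have [g hg] := choice (fun i => let: ex_intro2 g h1 h2 := W12_0_closure (zPsi i) in ex_intro _ g (conj h1 h2)).
have [g' hg'] := choice (fun i => let: ex_intro2 g h1 h2 := W12_0_closure (zPsi' i) in ex_intro _ g (conj h1 h2)).
pose rho i p := cpt Psi' i p - cpt Psi i p.
have srho i : smooth_on setT (rho i) := smooth_sub (sPsi' i) (sPsi i).
have rho0 i p : sqn p = 1 -> rho i p = 0.
  by move=> /boundary_disk hp; rewrite /rho /cpt bPsi// bPsi'// subrr.
(* [G] is the gradient of [w] as a limit of test functions, [D] below its gradient given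
   by the two solutions; both are weak gradients of [w]. *)
pose w i p := cpt v i p + (-1) * cpt u i p.
pose G i j p := g' i j p + ((-1) * g i j p + pd j (rho i) p).
have wE i : (fun p => cpt v i p - cpt Psi' i p + ((-1) * (cpt u i p - cpt Psi i p) + rho i p)) = w i.
  by apply/funext => p; rewrite /w /rho; move: (cpt v i p) (cpt u i p) (cpt Psi i p) (cpt Psi' i p) => *; ring.
have sG i : W12_closure (w i) (G i).
  rewrite -wE; have s1 := W12_closureN (sum_ord2 (R := R)) (hg i).2.
  have s2 := W12_closureD (sum_ord2 (R := R)) s1 (smooth_W12_closure (srho i) (rho0 i)).
  have := W12_closureD (sum_ord2 (R := R)) (hg' i).2 s2; exact.
have wG i : W12_grad B (w i) (G i).
  rewrite -wE; have s2 := W12_gradD (W12_gradN (hg i).1) (W12_grad_smooth (srho i)).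
  by have := W12_gradD (hg' i).1 s2; exact.
pose D i j p := Dv i j p + (-1) * Du i j p.
have wD i : W12_grad B (w i) (D i) := W12_gradD (wDv i) (W12_gradN (wDu i)).
have LDv i j : L2 B (Dv i j) := W12_grad_L2 j (wDv i).
have LDu i j : L2 B (Du i j) := W12_grad_L2 j (wDu i).
have eq0 i phi : test_fun B phi -> Int (lame_integrand m l G i (fun j => pd j phi)) = 0.
  move=> tp; rewrite (lame_integrand_same (sum_ord2 (R := R)) m l i wG wD tp).
  by apply: (lame_integrand_diff (sum_ord2 (R := R)) LDv LDu tp); [exact: eDv|exact: eDu].
have z := W12_closure_unique ord2_neq01 ord2P (sum_ord2 (R := R)) m0 ml0 sG eq0.
have Lw i : L2 B (w i) by case: (sG i).
have h0 := ae_zero (Lw 0).1 (L2_sqr (Lw 0)) (z 0).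
have h1 := ae_zero (Lw 1).1 (L2_sqr (Lw 1)) (z 1).
apply: (@filterS2 _ _ (ae_filter_ringOfSetsType mu) _ _ _ _ h0 h1) => p {}h0 {}h1 Bp.
have := h0 Bp; have := h1 Bp; rewrite /w /cpt /= => e1 e0.
by rewrite (surjective_pairing (v p)) (surjective_pairing (u p)); congr pair; lra.
Qed.

Lemma smooth_lame (Phi u : R * R -> R * R) :
  (forall i, smooth_on setT (cpt u i)) ->
  (forall p, sqn p = 1 -> u p = Phi p) ->
  (forall i p, m * (\sum_(j < 2) (pd j (pd j (cpt u i)) p + pd j (pd i (cpt u j)) p)) +
    l * (\sum_(j < 2) pd i (pd j (cpt u j)) p) = 0) ->
  lame_solution m l B Phi u.
Proof.
move=> su bu pde; split.
  exists u; split; [exact: su|by move=> p /boundary_disk /bu|].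
  move=> i; rewrite (_ : (fun p => _) = (fun=> 0)); first exact: W12_0_zero.
  by apply/funext => p; rewrite subrr.
exists (fun i j => pd j (cpt u i)); split; first by move=> i; exact: W12_grad_smooth.
by move=> i phi tp; exact: (smooth_lame_integrand (sum_ord2 (R := R)) su tp (pde i)).
Qed.

End Lame.

(** * Preimages under homeomorphisms of the plane *)

Section Homeo.
Variable R : realType.
Implicit Types (F G : R * R -> R * R) (A : set (R * R)).

Lemma cptK F : F = fun p => (cpt F 0 p, cpt F 1 p).
Proof. by apply/funext => p; rewrite -surjective_pairing. Qed.

Lemma cpt_continuous F : (forall i, continuous (cpt F i)) -> continuous F.
Proof. by move=> h; rewrite (cptK F) => p; exact: (cvg_pair (h 0 p) (h 1 p)). Qed.

Lemma open_preimage F A : continuous F -> open A -> open (F @^-1` A).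
Proof. by move=> cF oA; apply: open_comp => // p _; exact: cF. Qed.

Lemma boundary_preimage F G A : continuous F -> continuous G ->
  cancel F G -> cancel G F -> open A ->
  boundary (G @^-1` A) = G @^-1` boundary A.
Proof.
move=> cF cG FK GK oA; rewrite /boundary.
rewrite (proj1 (interior_id _) (open_preimage cG oA)) (proj1 (interior_id _) oA).
have E q : closure (G @^-1` A) q <-> closure A (G q).
  split=> h V hV.
    by have [r [Ar Vr]] := h _ (cG q _ hV); exists (G r).
  have : nbhs (G q) (F @^-1` V) by apply: cF; rewrite GK.
  move=> /h[r [Ar Vr]]; exists (F r); split => //.
  by rewrite /preimage /= FK.
by apply/seteqP; split=> q [/E h1 h2]; split => //; apply/E.
Qed.

End Homeo.

(** * Quadratic polynomials *)

Section Quadratic.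
Variable R : realType.

Definition quad (a0 a1 a2 a3 a4 a5 : R) (p : R * R) : R :=
  a0 + a1 * p.1 + a2 * p.2 + a3 * p.1 ^+ 2 + a4 * (p.1 * p.2) + a5 * p.2 ^+ 2.

Lemma smooth_quad a0 a1 a2 a3 a4 a5 : smooth_on setT (quad a0 a1 a2 a3 a4 a5).
Proof.
have s1 := @smooth_fst R; have s2 := @smooth_snd R.
have h0 := smooth_add (smooth_cst a0) (smooth_scale a1 s1).
have h1 := smooth_add h0 (smooth_scale a2 s2).
have h2 := smooth_add h1 (smooth_scale a3 (smooth_sqr s1)).
have h3 := smooth_add h2 (smooth_scale a4 (smooth_mul s1 s2)).
exact: smooth_add h3 (smooth_scale a5 (smooth_sqr s2)).
Qed.

Lemma pd0_quad a0 a1 a2 a3 a4 a5 :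
  pd 0 (quad a0 a1 a2 a3 a4 a5) = quad a1 (2 * a3) a4 0 0 0.
Proof.
apply/funext => -[x y].
have := is_derive_axis1 y x (smooth_quad a0 a1 a2 a3 a4 a5).
move=> /@derive_val <-; rewrite /quad /=.
apply: derive_val; apply: is_derive_eq; rewrite /GRing.scale /=; ring.
Qed.

Lemma pd1_quad a0 a1 a2 a3 a4 a5 :
  pd 1 (quad a0 a1 a2 a3 a4 a5) = quad a2 a4 (2 * a5) 0 0 0.
Proof.
apply/funext => -[x y].
have := is_derive_axis2 x y (smooth_quad a0 a1 a2 a3 a4 a5).
move=> /@derive_val <-; rewrite /quad /=.
apply: derive_val; apply: is_derive_eq; rewrite /GRing.scale /=; ring.
Qed.

End Quadratic.

(** * The convex domain *)

Section Domain.
Variable R : realType.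
Variable d : R.
Hypothesis d0 : d != 0.
Implicit Types (p q : R * R) (i j : 'I_2).
Local Notation B := (disk ((0:R), (0:R)) 1).

(** The map [(x, y) -> (x - y, x + y)] followed by the shear that adds a quarter
    of the square of the second coordinate to the first one, and by the dilation by [d] of
    the second axis. *)
Definition shear p : R * R := (p.1 - p.2 + (p.1 + p.2) ^+ 2 / 4, d * (p.1 + p.2)).
Definition unshear q : R * R :=
  ((q.2 / d + (q.1 - (q.2 / d) ^+ 2 / 4)) / 2, (q.2 / d - (q.1 - (q.2 / d) ^+ 2 / 4)) / 2).

Lemma shearK : cancel shear unshear.
Proof.
move=> [x y]; rewrite /shear /unshear /= [d * _]mulrC mulfK//.
by congr pair; field.
Qed.

Lemma unshearK : cancel unshear shear.
Proof.
move=> [x y]; rewrite /shear /unshear /=.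
by congr pair; field.
Qed.

Lemma smooth_shear i : smooth_on setT (cpt shear i).
Proof.
case: (ord2P i) => ->.
  rewrite (_ : cpt shear 0 = quad 0 1 (-1) (1 / 4) (1 / 2) (1 / 4)); first exact: smooth_quad.
  by apply/funext => p; rewrite /cpt /quad /shear /=; field.
rewrite (_ : cpt shear 1 = quad 0 d d 0 0 0); first exact: smooth_quad.
by apply/funext => p; rewrite /cpt /quad /shear /=; ring.
Qed.

Lemma smooth_unshear i : smooth_on setT (cpt unshear i).
Proof.
case: (ord2P i) => ->.
  rewrite (_ : cpt unshear 0 = quad 0 (1 / 2) (d^-1 / 2) 0 0 (- (d^-1 ^+ 2 / 8))).
    exact: smooth_quad.
  by apply/funext => p; rewrite /cpt /quad /unshear /=; field.
rewrite (_ : cpt unshear 1 = quad 0 (- (1 / 2)) (d^-1 / 2) 0 0 (d^-1 ^+ 2 / 8)).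
  exact: smooth_quad.
by apply/funext => p; rewrite /cpt /quad /unshear /=; field.
Qed.

Lemma continuous_shear : continuous shear.
Proof. by apply: cpt_continuous => i; exact: smooth_cont (smooth_shear i). Qed.

Lemma continuous_unshear : continuous unshear.
Proof. by apply: cpt_continuous => i; exact: smooth_cont (smooth_unshear i). Qed.

Definition sheared : set (R * R) := unshear @^-1` B.

(** In the coordinates [s = q.2 / d] and [q.1 - s ^+ 2 / 4] the domain is the
    disk of radius [sqrt 2]. *)
Lemma shearedE q : sheared q <->
  (q.2 / d) ^+ 2 + (q.1 - (q.2 / d) ^+ 2 / 4) ^+ 2 < 2.
Proof.
rewrite /sheared /preimage diskE /sqn /unshear /=.
move: (q.2 / d) (q.1 - _) => s t.
have -> : ((s + t) / 2) ^+ 2 + ((s - t) / 2) ^+ 2 = (s ^+ 2 + t ^+ 2) / 2 by field.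
by split; lra.
Qed.

Lemma sheared_open : open sheared.
Proof. exact: open_preimage continuous_unshear (@disk_open R). Qed.

Lemma boundary_sheared : boundary sheared = unshear @^-1` boundary B.
Proof.
exact: (boundary_preimage continuous_shear continuous_unshear shearK unshearK (@disk_open R)).
Qed.

Lemma sheared0 : sheared (0, 0).
Proof. by apply/shearedE => /=; rewrite mul0r expr0n /= mul0r subr0 expr0n /= addr0. Qed.

Lemma sheared_image : sheared = shear @` B.
Proof.
apply/seteqP; split=> [q hq|_ [p hp <-]].
  by exists (unshear q); [exact: hq|exact: unshearK].
by rewrite /sheared /preimage /= shearK.
Qed.

Lemma sheared_bounded : bounded_set sheared.
Proof.
have : compact (shear @` cdisk (R := R)).
  by apply: continuous_compact (@cdisk_compact R); apply: continuous_subspaceT; exact: continuous_shear.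
move=> /compact_bounded [M [Mr hM]]; exists M; split => // x Mx q.
rewrite sheared_image => -[p hp <-]; apply: (hM x Mx).
by exists p => //; move: hp; rewrite diskE => /ltW.
Qed.

(** A convex combination in the sheared coordinates moves the first one by
    [E / 4] with [E = t * (1 - t) * (s1 - s2) ^+ 2].  The strict convexity of the disk
    leaves a margin of [E], while the displacement costs at most
    [2 * (3 / 2) * (E / 4) + (E / 4) ^+ 2 <= 7 / 8 * E]. *)
Lemma convex_arith (t s1 s2 m1 m2 : R) : 0 <= t <= 1 ->
  s1 ^+ 2 + m1 ^+ 2 < 2 -> s2 ^+ 2 + m2 ^+ 2 < 2 ->
  (t * s1 + (1 - t) * s2) ^+ 2 +
  (t * m1 + (1 - t) * m2 + t * (1 - t) * (s1 - s2) ^+ 2 / 4) ^+ 2 < 2.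
Proof.
move=> /andP[t0 t1] h1 h2.
pose P := t * m1 + (1 - t) * m2; pose E := t * (1 - t) * (s1 - s2) ^+ 2.
have tau0 : 0 <= t * (1 - t) by rewrite mulr_ge0//; lra.
have tau1 : t * (1 - t) <= 1 / 4 by have := sqr_ge0 (2 * t - 1); lra.
have E0 : 0 <= E by rewrite mulr_ge0// sqr_ge0.
have D8 : (s1 - s2) ^+ 2 <= 8.
  have := sqr_ge0 (s1 + s2); have := sqr_ge0 m1; have := sqr_ge0 m2; lra.
have E2 : E <= 2.
  have : t * (1 - t) * (s1 - s2) ^+ 2 <= 1 / 4 * 8 by apply: ler_pM => //; exact: sqr_ge0.
  rewrite /E; lra.
have M : t * (s1 ^+ 2 + m1 ^+ 2) + (1 - t) * (s2 ^+ 2 + m2 ^+ 2) < 2.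
  have [->|tn] := eqVneq t 0; first lra.
  have tp : 0 < t by rewrite lt_neqAle eq_sym tn.
  have a1 : t * (s1 ^+ 2 + m1 ^+ 2) < t * 2 by rewrite ltr_pM2l.
  have a2 : (1 - t) * (s2 ^+ 2 + m2 ^+ 2) <= (1 - t) * 2 by rewrite ler_wpM2l//; lra.
  lra.
have Q : (t * s1 + (1 - t) * s2) ^+ 2 + P ^+ 2 < 2 - E.
  have : 0 <= t * (1 - t) * (m1 - m2) ^+ 2 by rewrite mulr_ge0// sqr_ge0.
  have -> : (t * s1 + (1 - t) * s2) ^+ 2 + P ^+ 2 =
    t * (s1 ^+ 2 + m1 ^+ 2) + (1 - t) * (s2 ^+ 2 + m2 ^+ 2) - E - t * (1 - t) * (m1 - m2) ^+ 2.
    by rewrite /P /E; ring.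
  lra.
have S0 := sqr_ge0 (t * s1 + (1 - t) * s2).
rewrite -/P -/E; clearbody P E; clear M D8 tau0 tau1.
(* [9 / 4] exceeds the bound [2] on [P ^+ 2]. *)
have P2 : P <= 3 / 2.
  rewrite leNgt; apply/negP => hP; have : 0 < (P - 3 / 2) * (P - 3 / 2) by rewrite mulr_gt0// subr_gt0.
  lra.
have := ler_wpM2r E0 P2; have := ler_wpM2r E0 E2.
have -> : (P + E / 4) ^+ 2 = P ^+ 2 + P * E / 2 + E * E / 16 by field.
lra.
Qed.

Lemma sheared_convex : convex_set sheared.
Proof.
move=> x y t; rewrite !inE => /shearedE hx /shearedE hy; apply/shearedE.
have t01 : 0 <= t%:num <= 1 by apply/andP; split.
rewrite /conv /=; move: (t%:num) t01 => {}t t01.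
have := convex_arith t01 hx hy.
set s1 := x.2 / d; set s2 := y.2 / d.
have E1 : (t *: (x.2 : R) + unstable.onem t *: (y.2 : R)) / d = t * s1 + (1 - t) * s2.
  by rewrite /s1 /s2 /unstable.onem /GRing.scale /=; field.
rewrite E1.
congr (_ + _ < _); rewrite /unstable.onem /GRing.scale /=; congr (_ ^+ 2).
by field.
Qed.

Lemma sheared_connected : connected sheared.
Proof.
(* The disk is a union of segments from its centre. *)
have -> : sheared = \bigcup_(p in B) ((fun t : R => shear (t * p.1, t * p.2)) @` `[0, 1]).
  rewrite sheared_image; apply/seteqP; split=> [_ [p hp <-]|_ [p hp [t ht <-]]].
    exists p => //; exists 1; first by rewrite /= in_itv /= ler01 lexx.
    by rewrite !mul1r -surjective_pairing.
  exists (t * p.1, t * p.2) => //; move: hp ht; rewrite diskE /sqn /= in_itv /= => hp /andP[t0 t1].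
  by rewrite !exprMn -mulrDr (le_lt_trans _ hp)// ler_piMl ?addr_ge0 ?sqr_ge0// expr_le1.
apply: bigcup_connected.
  exists (shear (0, 0)) => p hp /=; exists 0; last by rewrite !mul0r.
  by rewrite in_itv /= ler01 lexx.
move=> p hp; apply: connected_continuous_connected; first exact: segment_connected.
apply: continuous_subspaceT => t.
have h (a : R) : continuous (fun t : R => t * a).
  by move=> s; apply: cvgM; [exact: cvg_id|exact: cvg_cst].
have c : {for t, continuous (fun t : R => (t * p.1, t * p.2))}.
  exact: (cvg_pair (h p.1 t) (h p.2 t)).
by apply: continuous_comp; [exact: c|exact: continuous_shear].
Qed.

Lemma smooth_map_poly A (F : R * R -> R * R) : (forall i, smooth_on setT (cpt F i)) ->
  smooth_map A F.
Proof.
by move=> sF p Ap; exists setT, F; split; [exact: openT| |exact: sF|].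
Qed.

Lemma shear_diffeo : smooth_diffeo (boundary B) (boundary sheared) shear.
Proof.
split.
- split.
  + by move=> p hp; rewrite boundary_sheared /preimage /= shearK.
  + by move=> p q _ _ /(can_inj shearK).
  + move=> q; rewrite boundary_sheared => hq; exists (unshear q) => //; exact: unshearK.
- exact: smooth_map_poly smooth_shear.
exists unshear; split; first exact: smooth_map_poly smooth_unshear.
by move=> p _; exact: shearK.
Qed.

End Domain.

(** * The solution that leaves the domain *)

Section Solution.
Variable R : realType.
Variables m l : R.
Hypotheses (m0 : 0 < m) (ml0 : 0 < m + l).
Implicit Types (p q : R * R) (i j : 'I_2).
Local Notation B := (disk ((0:R), (0:R)) 1).
Local Notation mu := (@leb2 R).

(** The coefficient for which the second equation holds: with the mixed
    derivative [1 / 2] of the first component it reads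
    [(m + l) / 2 = 2 * c * (3 * m + l)]. *)
Definition lift_height : R := (m + l) / (4 * (3 * m + l)).
Local Notation c := lift_height.

Lemma lift_height_gt0 : 0 < c.
Proof.
have h : 0 < 3 * m + l by have := m0; have := ml0; lra.
by rewrite /lift_height divr_gt0// mulr_gt0.
Qed.

(** On the circle [1 + 2 * x * y] is [(x + y) ^+ 2], so this agrees with
    [shear (c / 2)] there. *)
Definition sol p : R * R :=
  (p.1 - p.2 + (1 + 2 * (p.1 * p.2)) / 4,
   c / 2 * (p.1 + p.2) + c * (1 - p.1 ^+ 2 - p.2 ^+ 2)).

Lemma sol0 : cpt sol 0 = quad (1 / 4) 1 (-1) 0 (1 / 2) 0.
Proof. by apply/funext => p; rewrite /cpt /sol /quad /=; field. Qed.

Lemma sol1 : cpt sol 1 = quad c (c / 2) (c / 2) (- c) 0 (- c).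
Proof. by apply/funext => p; rewrite /cpt /sol /quad /=; field. Qed.

Lemma sol_solves_lame : lame_solution m l B (shear (c / 2)) sol.
Proof.
apply: smooth_lame.
- by move=> i; case: (ord2P i) => ->; rewrite ?sol0 ?sol1; exact: smooth_quad.
- move=> p hp; have hp' : p.1 ^+ 2 + p.2 ^+ 2 = 1 := hp.
  rewrite /sol /shear; congr pair.
    have -> : (p.1 + p.2) ^+ 2 = p.1 ^+ 2 + p.2 ^+ 2 + 2 * (p.1 * p.2) by ring.
    by rewrite hp'.
  have -> : 1 - p.1 ^+ 2 - p.2 ^+ 2 = 0 by rewrite -hp'; ring.
  by rewrite mulr0 addr0.
move=> i p; rewrite !sum_ord2.
have k0 : 3 * m + l != 0 by apply: lt0r_neq0; have := m0; have := ml0; lra.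
case: (ord2P i) => ->; rewrite sol0 sol1 !(pd0_quad, pd1_quad) /quad /lift_height; field => //.
Qed.

(** Otherwise the two functions differ on a square around [p], which has
    positive area. *)
Lemma ae_eq_cont (u v : R * R -> R) p : B p -> {for p, continuous u} -> {for p, continuous v} ->
  {ae mu, forall q, B q -> v q = u q} -> v p = u p.
Proof.
move=> Bp cu cv [N [mN N0 hN]].
apply/eqP; apply: contrapT => /negP uv.
have : \forall q \near p, u q - v q != 0.
  have cB : {for p, continuous (fun q => u q - v q)} by apply: continuousB.
  have : open [set x : R | x != 0] by exact: open_neq.
  move=> o; apply: (cB [set x | x != 0]); apply: open_nbhs_nbhs; split => //=.
  by rewrite subr_eq0 eq_sym.
have : \forall q \near p, B q by apply: open_nbhs_nbhs; split; [exact: disk_open|].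
move=> h1 h2.
have /nbhs_ballP[e /= e0 he] : nbhs p (B `&` [set q | u q - v q != 0]) by exact: filterI.
have sub : box p.1 p.2 e `<=` N.
  move=> q /boxE[q1 q2]; apply: hN => /= hq.
  have /he [Bq /eqP] : ball p e q by split; rewrite /ball /= distrC.
  by apply; rewrite (hq Bq) subrr.
have : (mu (box p.1 p.2 e) <= mu N)%E.
  by apply: le_measure; rewrite ?inE//; exact: measurable_box.
have e0' : 0 < (2 * e) ^+ 2 by rewrite exprn_gt0// mulr_gt0.
by rewrite N0 (leb2_box _ _ (ltW e0)) lee_fin leNgt e0'.
Qed.

(** The centre is sent to height [c], that is to [s = 2] in the coordinates of
    [shearedE], and [s ^+ 2 = 4] exceeds the bound [2]. *)
Lemma sol_not_homeo v : {ae mu, forall p, B p -> v p = sol p} ->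
  ~ homeo B (sheared (c / 2)) v.
Proof.
move=> vu [[vD _ _] cv _].
have B0 : B (0, 0) by rewrite diskE /sqn /= expr0n /= addr0.
have c0 := lift_height_gt0.
have cv0 : {for (0, 0), continuous v}.
  have iB : (interior B) (0, 0) by rewrite (proj1 (interior_id _) (@disk_open R)).
  by have /subspace_continuousP/(_ _ B0) := cv; rewrite within_interior.
have c1 : {for (0, 0), continuous (cpt sol 1)}.
  by rewrite sol1; exact: (smooth_cont (smooth_quad _ _ _ _ _ _)).
have c2 : {for (0, 0), continuous (cpt v 1)}.
  have := @continuous_comp _ _ _ v snd (0, 0) cv0; apply; exact: cvg_snd.
have h2 : (v (0, 0)).2 = (sol (0, 0)).2.
  apply: (ae_eq_cont B0 c1 c2).
  apply: (@filterS _ _ (ae_filter_ringOfSetsType mu) _ _ _ vu) => q h Bq.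
  by rewrite /cpt h.
have := vD _ B0; have d0 : c / 2 != 0 by rewrite gt_eqF//; lra.
move=> /shearedE; rewrite h2 /sol /=.
have -> : (c / 2 * (0 + 0) + c * (1 - 0 ^+ 2 - 0 ^+ 2)) / (c / 2) = 2.
  by field; rewrite gt_eqF.
have := sqr_ge0 ((v (0, 0)).1 - 2 ^+ 2 / 4); lra.
Qed.

End Solution.

Theorem theorem1p2 (R : realType) (mu lambda : R)
  (hmu : 0 < mu) (hmulambda : 0 < mu + lambda) :
  exists (c : R * R) (r : R) (D : set (R * R)) (Phi : R * R -> R * R),
    let B := disk c r in
    [/\ 0 < r,
        [/\ open D, connected D, D !=set0, bounded_set D & convex_set D],
        smooth_diffeo (boundary B) (boundary D) Phi &
        exists u : R * R -> R * R,
          [/\ lame_solution mu lambda B Phi u,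
              forall v, lame_solution mu lambda B Phi v ->
                {ae @leb2 R, forall p, B p -> v p = u p} &
              forall v, {ae @leb2 R, forall p, B p -> v p = u p} ->
                ~ homeo B D v]].
Proof.
have d0 : lift_height mu lambda / 2 != 0.
  by have := lift_height_gt0 hmu hmulambda; move=> h; rewrite gt_eqF// divr_gt0.
pose d := lift_height mu lambda / 2.
exists (0, 0), 1, (sheared d), (shear d); split.
- exact: ltr01.
- split; [exact: sheared_open|exact: sheared_connected| |exact: sheared_bounded|exact: sheared_convex].
  by exists (0, 0); exact: sheared0.
- exact: shear_diffeo.
have hu := sol_solves_lame hmu hmulambda.
exists (sol mu lambda); split; first exact: hu.
  by move=> v hv; exact: (lame_unique hmu hmulambda hu hv).
by move=> v vu; exact: sol_not_homeo.
Qed.
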